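(* Let $N=2^k\ge16$ and $\rho=3N/8-1$. For every marked column of every matrix in the signed row/column equivalence class of the Sylvester matrix of order $N$, with associated Hadamard simplex $\Delta$ of dimension $d=N-1$ and polytopes $P_{m,n}=m\Delta\cap[-n,n]^d$, and for all positive odd integers $n<m<(N-1)n$: $$m\ge\rho n\ \Longrightarrow\ P_{m,n}\text{ is integral},\qquad m\ge\rho n+N-2\ \Longrightarrow\ P_{m,n}\text{ is normal}.$$ Moreover, for every positive odd $n$, the value $m=\rho n-2$ is admissible (odd with $n<m<(N-1)n$) and $P_{\rho n-2,\,n}$ has a vertex not in $\Lambda_n=(n+2\mathbb Z)^d$. Thus $\rho$ is the sharp coefficient for a uniform upper integrality band: for every real $c<\rho$ there are positive odd integers $n<m<(N-1)n$ with $m\ge cn$ such that $P_{m,n}$ is not integral.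
   Context: The Sylvester matrix of order $N=2^k$ has rows and columns indexed by $\mathbb F_2^k$ and entries $(-1)^{r\cdot j}$ in row $r$, column $j$ (dot product over $\mathbb F_2$). Signed row/column (Hadamard) equivalence allows permutations and sign changes of rows and columns. Given a Hadamard matrix of order $N$ with a marked column, multiply rows by signs so that the marked column becomes all ones, and delete it. With $d=N-1$, the remaining rows $v_0,\dots,v_{N-1}\in\{\pm1\}^d$ are the vertices of the associated Hadamard simplex $\Delta=\operatorname{conv}\{v_i\}=\{x\in\mathbb R^d: v_i\cdot x\ge-1\ \forall i\}$. For positive odd $n<m<dn$, $P_{m,n}=m\Delta\cap[-n,n]^d$ and $\Lambda_n=(n+2\mathbb Z)^d$. $P_{m,n}$ is integral if all its vertices lie in $\Lambda_n$. $P_{m,n}$ is normal if, for every integer $r\ge1$, every point of $rP_{m,n}\cap(rn+2\mathbb Z)^d$ is a sum of $r$ points of $P_{m,n}\cap\Lambda_n$ (equivalently, with $Q_{m,n}=(P_{m,n}+n\mathbf 1)/2$, every point of $rQ_{m,n}\cap\mathbb Z^d$ is a sum of $r$ points of $Q_{m,n}\cap\mathbb Z^d$). *)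

(* Defs.v *)
From HB Require Import structures.
From mathcomp Require Import all_boot all_order all_algebra all_fingroup.
From mathcomp Require Import boolp classical_sets reals.

Set Implicit Arguments.
Unset Strict Implicit.
Unset Printing Implicit Defensive.

Import Order.TTheory GRing.Theory Num.Theory.

Local Open Scope classical_set_scope.
Local Open Scope ring_scope.

Lemma card_F2_row k : #|{: 'rV['F_2]_k}| = (2 ^ k)%N.
Proof. by rewrite card_mx card_Fp // mul1n. Qed.

Definition F2_index k (i : 'I_(2 ^ k)) : 'rV['F_2]_k :=
  enum_val (cast_ord (esym (card_F2_row k)) i).

(* The dot product is an element of 'F_2, read in the exponent as 0 or 1. *)
Definition sylvester (R : nzRingType) k : 'M[R]_(2 ^ k) :=
  \matrix_(r, j) (-1) ^+ (F2_index r *m (F2_index j)^T) 0 0.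

Definition signed_equiv (R : nzRingType) N (A B : 'M[R]_N) : Prop :=
  exists (p q : 'S_N) (s t : 'I_N -> bool),
    forall i j, A i j = (-1) ^+ s i * B (p i) (q j) * (-1) ^+ t j.

Section Polytopes.
Variable R : realType.

Definition conv_hull d I (v : 'I_I -> 'rV[R]_d) : set 'rV[R]_d :=
  [set x : 'rV[R]_d | exists a : 'I_I -> R,
    [/\ forall i, 0 <= a i, \sum_i a i = 1 & x = \sum_i a i *: v i]].

Definition dilate d (c : R) (P : set 'rV[R]_d) : set 'rV[R]_d :=
  [set c *: x | x in P].

(* Vertices of a polytope, as its extreme points. *)
Definition vertex d (P : set 'rV[R]_d) (v : 'rV[R]_d) : Prop :=
  P v /\ forall x y (t : R), P x -> P y -> 0 < t < 1 ->
    v = t *: x + (1 - t) *: y -> x = v /\ y = v.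

Definition cube d (n : nat) : set 'rV[R]_d :=
  [set x : 'rV[R]_d | forall i, - n%:R <= x 0 i <= n%:R].

(* (n + 2 Z)^d *)
Definition shifted_lattice d (n : nat) : set 'rV[R]_d :=
  [set x : 'rV[R]_d | forall i, exists z : int, x 0 i = n%:R + 2 * z%:~R].

(* For a matrix with entries 1 and -1, the sign that turns the entry of row i
   in the marked column j into 1 is that entry itself. *)
Definition simplex_vertex N (A : 'M[R]_N) (j i : 'I_N) : 'rV[R]_N.-1 :=
  A i j *: row i (col' j A).

Definition hadamard_simplex N (A : 'M[R]_N) (j : 'I_N) : set 'rV[R]_N.-1 :=
  conv_hull (simplex_vertex A j).

Definition truncated_simplex N (A : 'M[R]_N) (j : 'I_N) (m n : nat) :
    set 'rV[R]_N.-1 :=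
  dilate m%:R (hadamard_simplex A j) `&` cube n.

Definition admissible (N m n : nat) : bool :=
  [&& odd n, odd m, n < m & m < N.-1 * n]%N.

Definition integral_polytope N (A : 'M[R]_N) (j : 'I_N) (m n : nat) : Prop :=
  forall v, vertex (truncated_simplex A j m n) v -> shifted_lattice n v.

Definition normal_polytope N (A : 'M[R]_N) (j : 'I_N) (m n : nat) : Prop :=
  let P := truncated_simplex A j m n in
  forall (r : nat) (x : 'rV[R]_N.-1), (1 <= r)%N ->
    dilate r%:R P x -> shifted_lattice (r * n) x ->
    exists y : 'I_r -> 'rV[R]_N.-1,
      (forall i, (P `&` shifted_lattice n) (y i)) /\ x = \sum_i y i.

Definition rho (N : nat) : R := 3 * N%:R / 8 - 1.

End Polytopes.

(* Main.v *)
Require Import Defs.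
From mathcomp Require Import all_boot all_order all_algebra perm.
From mathcomp Require Import classical_sets reals.
From mathcomp Require Import ring lra zify.
Import Order.TTheory GRing.Theory Num.Theory.
Local Open Scope ring_scope.
Set Implicit Arguments.
Unset Strict Implicit.

(** Multiplying coordinates by signs and permuting them changes neither the
    cube nor the lattice, so the polytope can be studied on functions f on
    V = F_2^k with f 0 = m: the coordinates are the values f a for a nonzero, and
    the facet of the simplex attached to u says that the Fourier transform
    [hat f u] = sum_a (-1)^(u.a) f a is nonnegative ([simplexP], [truncatedP]).
    A point is a vertex exactly when no nonzero direction is killed by all its
    tight constraints ([vertexP]).

    Where rho comes from.  For four distinct rows with sum S of characters,
    4|S| = S^2 + 2 - 2 chi, where chi is the product of the four characters; so
    the mean of |S| is 3/2 when the rows do not add to zero, and 1 otherwise.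
    As S(0) = 4 and |f| <= n off 0, the four transforms add up to at least
    4m - 4 rho n ([four_rows_le]).  Hence above the threshold at most three rows
    can be small simultaneously.

    Three rows p, q, s are harmless.  The forms [hat f p],
    ([hat f p] - [hat f q])/2 and ([hat f p] - [hat f s])/2 are, up to the signs
    chi_p and a factor, sums of f over V and over two subsets of V, and any two
    subsets of a finite set are intervals of one enumeration of it
    ([interval_order]).  In terms of prefix sums, bounds on these
    forms and on single coordinates are bounds on differences, and those are
    preserved by every rounding of the prefix sums.  If p, q, s are the rows with
    the three smallest transforms, the three forms also carry the inequalities
    for these rows.
    - Vertices ([rigid_integral]): with at most three tight rows, a coordinate
      off the lattice would give a perturbation, the increment of the indicator
      of one class of prefix sums modulo integers ([three_integral]).  When
      m = rho n four rows may be tight; then equality in the four-row estimate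
      pins every coordinate where S is nonzero, no fifth row is tight, and where
      S vanishes the four equations amount to separate equations on cells of
      even size N/8 ([tight4_integral]).
    - Normality ([split_off]): a lattice point F of rP is the sum over i < r of
      the points with prefix sums floor((P_j + i)/r), if P_j are the prefix sums
      of F with coordinates shifted to start at 0.  Each of them satisfies the
      cube constraints and the constraints of p, q, s.  On average their
      distance to F/r in the l1 norm is at most N - 1, so one of them is within
      N - 1; every other row has transform at least r(N - 2) at F, and as
      transforms of lattice points are even this leaves the piece in P and its
      complement in (r - 1)P.  Induction on r finishes.

    Sharpness.  For m = rho n - 2 one takes the point at which four independent
    rows would be tight for m = rho n, fills the cells where S = 0 by a fifth
    character, and moves one coordinate in each of the four cells with |S| = 2
    by one unit towards 0 ([example]).  The four rows become tight again and
    determine the four moved coordinates, whose values have the wrong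
    parity. *)

(** * Characters of the binary space *)

Definition chi (R : pzRingType) k (u a : 'rV['F_2]_k) : R :=
  (-1) ^+ (u *m a^T) 0 0.

(** The order 2 ^ k of the matrix, sealed so that it is an indeterminate in
    linear arithmetic. *)
Definition order2 (R : pzSemiRingType) k : R := locked (2 ^ k)%:R.

Lemma order2E (R : pzSemiRingType) k : order2 R k = (2 ^ k)%:R.
Proof. by rewrite /order2 -lock. Qed.

Section Characters.
Variables (R : realDomainType) (k : nat).
Local Notation V := 'rV['F_2]_k.
Local Notation chi := (@chi R k).
Local Notation N := (order2 R k).
Implicit Types (u v a b : V).

Lemma signF2D (x y : 'F_2) : (-1) ^+ (x + y)%R = (-1) ^+ x * (-1) ^+ y :> R.
Proof.
by move: x y => [[|[|x]] ?] [[|[|y]] ?] //=; rewrite ?expr0 ?expr1 ?mulr1 ?mul1r ?mulrNN ?mulr1.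
Qed.

Lemma chiC u a : chi u a = chi a u.
Proof. by rewrite /chi -[in LHS](trmxK u) -trmx_mul mxE. Qed.

Lemma chiDr u a b : chi u (a + b) = chi u a * chi u b.
Proof. by rewrite /chi linearD /= mulmxDr mxE signF2D. Qed.

Lemma chiDl u v a : chi (u + v) a = chi u a * chi v a.
Proof. by rewrite chiC chiDr !(chiC a). Qed.

Lemma chi0r u : chi u 0 = 1.
Proof. by rewrite /chi linear0 mulmx0 mxE. Qed.

Lemma chi0l a : chi 0 a = 1.
Proof. by rewrite chiC chi0r. Qed.

Lemma chi_sign u a : chi u a = 1 \/ chi u a = -1.
Proof. by rewrite /chi -signr_odd; case: odd; [right|left]. Qed.

Lemma chi_sq u a : chi u a * chi u a = 1.
Proof. by case: (chi_sign u a) => ->; rewrite ?mulr1 ?mulrNN ?mulr1. Qed.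

(** In characteristic two a translation is an involution. *)
Lemma addF2K u v : u + v + v = u.
Proof.
have vv : v + v = 0.
  by apply/rowP => i; rewrite !mxE; case: (v 0 i) => [[|[|x]] ?] //; apply/val_inj.
by rewrite -addrA vv addr0.
Qed.

Lemma addF2_eq0 u v : (u + v == 0) = (u == v).
Proof. by apply/eqP/eqP => [e|->]; [rewrite -(addF2K u v) e add0r | rewrite -{1}(add0r v) addF2K]. Qed.

Lemma chi_delta (i : 'I_k) a : chi (delta_mx 0 i) a = (-1) ^+ (a 0 i).
Proof. by rewrite /chi -rowE !mxE. Qed.

(** A nontrivial character changes sign under some translation. *)
Lemma sum_chi u : \sum_a chi u a = (u == 0)%:R * N.
Proof.
have [->|nz] := eqVneq u 0.
  rewrite (eq_bigr (fun=> 1)) => [|a _]; last exact: chi0l.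
  by rewrite sumr_const card_F2_row order2E mul1r.
have [i ui] : exists i, u 0 i != 0.
  apply/existsP; apply: contraNT nz; rewrite negb_exists => /forallP h.
  by apply/eqP/rowP => i; rewrite mxE; apply/eqP; move: (h i); rewrite negbK.
have ei : chi u (delta_mx 0 i) = -1.
  by rewrite chiC chi_delta; move: ui; case: (u 0 i) => [[|[|x]] ?].
have : \sum_a chi u a = \sum_a chi u (a + delta_mx 0 i).
  by apply: (reindex_inj (@addIr _ _)).
under [X in _ = X]eq_bigr do rewrite chiDr ei mulrN1.
by rewrite sumrN mul0r; move: (\sum_a _) => S; clear; lra.
Qed.

Lemma sum_chiM u v : \sum_a chi u a * chi v a = (u == v)%:R * N.
Proof. by rewrite -addF2_eq0 -sum_chi; apply: eq_bigr => a _; rewrite chiDl. Qed.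

(** The facet inequalities of the simplex, with the value at 0 playing the role
    of the dilation factor. *)
Definition hat (f : V -> R) u := \sum_a chi u a * f a.

(** Fourier inversion: the values of [hat f] are, up to a factor, the
    barycentric coordinates of the point with coordinates [f]. *)
Lemma hat_inv f a : \sum_u hat f u * chi u a = N * f a.
Proof.
rewrite /hat; under eq_bigr do rewrite mulr_suml.
rewrite exchange_big /= (bigD1 a) //= [X in _ + X]big1 => [|b /negPf ne].
  rewrite (eq_bigr (fun=> f a)) => [|u _]; last by rewrite mulrAC chi_sq mul1r.
  by rewrite sumr_const card_F2_row addr0 order2E mulr_natl.
rewrite (eq_bigr (fun u => chi b u * chi a u * f b)) => [|u _]; last first.
  by rewrite mulrAC !(chiC u).
by rewrite -mulr_suml sum_chiM ne !mul0r.
Qed.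

Lemma hatD f g u : hat (fun a => f a + g a) u = hat f u + hat g u.
Proof. by rewrite /hat -big_split; apply: eq_bigr => a _; rewrite mulrDr. Qed.

Lemma hatB f g u : hat (fun a => f a - g a) u = hat f u - hat g u.
Proof. by rewrite /hat -sumrB; apply: eq_bigr => a _; rewrite mulrBr. Qed.

Lemma hatZ x f u : hat (fun a => x * f a) u = x * hat f u.
Proof. by rewrite /hat mulr_sumr; apply: eq_bigr => a _; rewrite mulrCA. Qed.

Lemma eq_hat f g : f =1 g -> hat f =1 hat g.
Proof. by move=> fg u; apply: eq_bigr => a _; rewrite fg. Qed.

End Characters.

(** * Identities for signs *)

Section Signs.
Variable R : realDomainType.
Implicit Types p q r s u x y g : R.

Definition is_sign x := x = 1 \/ x = -1.

Lemma sign_neq : (1 == - 1 :> R) = false.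
Proof. by apply/negP => /eqP; lra. Qed.

Lemma sign_neqN : (- 1 == 1 :> R) = false.
Proof. by rewrite eq_sym sign_neq. Qed.

(** Among five signs three agree, and together with any fourth they do not
    cancel. *)
Lemma five_signs p q r s u : is_sign s -> is_sign u ->
  p + q + r + s = 0 -> u + q + r + s = 0 -> p + u + r + s = 0 ->
  p + q + u + s = 0 -> False.
Proof. by case=> ->; case=> ->; lra. Qed.

Lemma four_signs p q r s : is_sign p -> is_sign q -> is_sign r -> is_sign s ->
    p + q + r + s = 0 ->
  [\/ [/\ q = p, r = - p & s = - p], [/\ r = p, q = - p & s = - p]
    | [/\ s = p, q = - p & r = - p]].
Proof.
case=> ->; case=> ->; case=> ->; case=> -> e; rewrite ?opprK;
  by [apply: Or31|apply: Or32|apply: Or33|exfalso; lra].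
Qed.

Lemma opposite_signs p u g : is_sign p -> is_sign u ->
  2 * (if u == - p then p * g else 0) = p * g - u * g.
Proof.
by case=> ->; case=> ->; rewrite ?opprK ?eqxx ?sign_neq ?sign_neqN; ring.
Qed.

Lemma split_signs p q r s : is_sign p -> is_sign q -> is_sign r -> is_sign s ->
  [&& q == p, r == - p & s == - p]%:R * 8 = 1 + p * q + r * s
    + p * q * r * s - p * r - q * r - p * s - q * s.
Proof.
case=> ->; case=> ->; case=> ->; case=> ->;
  by rewrite ?opprK ?eqxx ?sign_neq ?sign_neqN /=; ring.
Qed.

(** If [x] is extremal, of size [y], whenever the four signs do not cancel, then
    the combination [p + q - r - s] isolates the cell where [p] and [q] are
    opposite to [r] and [s]; the last term compensates the extremal values. *)
Lemma split_value p q r s x y : is_sign p -> is_sign q -> is_sign r -> is_sign s ->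
    (p + q + r + s) * x = - (y * `|p + q + r + s|) ->
  [&& q == p, r == - p & s == - p]%:R * (4 * (p * x)) =
    (p * x + q * x - r * x - s * x) + y * (p * q - r * s).
Proof.
case=> ->; case=> ->; case=> ->; case=> ->;
  by rewrite ?opprK ?eqxx ?sign_neq ?sign_neqN /=;
     (rewrite ger0_norm; [|lra]) || (rewrite ler0_norm; [|lra]); lra.
Qed.

End Signs.

(** * Half sums of two rows *)

Section Opposite.
Variables (R : realDomainType) (k : nat).
Local Notation V := 'rV['F_2]_k.
Local Notation chi := (@chi R k).
Local Notation N := (order2 R k).

Definition opposite (p u : V) : {set V} := [set b | chi u b == - chi p b].

(** Comparing two rows amounts to summing over half of the coordinates; this is
    what makes parity arguments work. *)
Lemma sum_opposite (g : V -> R) p u :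
  2 * (\sum_(b in opposite p u) chi p b * g b) = hat g p - hat g u.
Proof.
rewrite /hat -sumrB big_mkcond mulr_sumr; apply: eq_bigr => b _.
by rewrite inE; apply: opposite_signs; apply: chi_sign.
Qed.

Lemma card_opposite p u : u != p -> 2 * (\sum_(b in opposite p u) 1) = N.
Proof.
move=> up; rewrite (eq_bigr (fun b => chi p b * chi p b)) => [|b _]; last by rewrite chi_sq.
by rewrite sum_opposite /hat !sum_chiM eqxx (negPf up) mul0r subr0 mul1r.
Qed.

Lemma order16 : (3 < k)%N -> N = 16 * (2 ^ (k - 4))%:R.
Proof. by move=> k3; rewrite order2E -natrM -(@expnD 2 4) subnKC. Qed.

End Opposite.

(** * Sums of four rows *)

Section FourRows.
Variables (R : realDomainType) (k : nat).
Local Notation V := 'rV['F_2]_k.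
Local Notation chi := (@chi R k).
Local Notation N := (order2 R k).
Implicit Types (u v a b p q r s : V) (f : V -> R).

Definition quad p q r s a := chi p a + chi q a + chi r a + chi s a.

(** A sum of four signs has absolute value 4, 2 or 0, so its absolute value is a
    quadratic function of it corrected by the product of the signs. *)
Lemma quad_norm p q r s a :
  4 * `|quad p q r s a| =
    quad p q r s a ^+ 2 + 2 - 2 * chi (p + q + r + s) a.
Proof.
rewrite /quad !chiDl.
case: (chi_sign R p a) => ->; case: (chi_sign R q a) => ->;
case: (chi_sign R r a) => ->; case: (chi_sign R s a) => ->;
by [rewrite ger0_norm; [ring | lra] | rewrite ler0_norm; [ring | lra]].
Qed.

Lemma sum_quad_sq p q r s : uniq [:: p; q; r; s] ->
  \sum_a quad p q r s a ^+ 2 = 4 * N.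
Proof.
rewrite /= !inE !negb_or => /and4P[/and3P[pq pr ps] /andP[qr qs] rs _].
rewrite (eq_bigr (fun a => (chi p a * chi p a + chi q a * chi q a
  + chi r a * chi r a + chi s a * chi s a)
  + (2 * (chi p a * chi q a) + 2 * (chi p a * chi r a)
  + 2 * (chi p a * chi s a) + 2 * (chi q a * chi r a)
  + 2 * (chi q a * chi s a) + 2 * (chi r a * chi s a)))); last first.
  by move=> a _; rewrite /quad; ring.
rewrite !big_split /= -!mulr_sumr !sum_chiM !eqxx.
rewrite (negPf pq) (negPf pr) (negPf ps) (negPf qr) (negPf qs) (negPf rs) /=.
by ring.
Qed.

Lemma sum_quad_norm p q r s : uniq [:: p; q; r; s] ->
  2 * (\sum_a `|quad p q r s a|) = (3 - (p + q + r + s == 0)%:R) * N.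
Proof.
move=> un; apply: (@mulfI _ 2); first by rewrite pnatr_eq0.
rewrite mulrA -natrM mulr_sumr.
under eq_bigr do rewrite quad_norm.
rewrite big_split /= big_split /= sum_quad_sq // sumr_const card_F2_row.
by rewrite -[2 *+ (2 ^ k)]mulr_natr -order2E sumrN -mulr_sumr sum_chi; ring.
Qed.

Lemma sum_hat4 f p q r s :
  hat f p + hat f q + hat f r + hat f s = \sum_a quad p q r s a * f a.
Proof.
by rewrite /hat -!big_split /=; apply: eq_bigr => a _; rewrite /quad; ring.
Qed.

Lemma quad0 p q r s : quad p q r s 0 = 4.
Proof. by rewrite /quad !chi0r; ring. Qed.

(** The sum on the left collects the slacks of |S f| <= B |S|, S being the sum of
    the four characters; keeping it gives the inequality and its equality case
    at once. *)
Lemma four_rows f (B : R) p q r s : uniq [:: p; q; r; s] ->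
    (forall a, a != 0 -> `|f a| <= B) ->
  2 * (\sum_(a | a != 0) (B * `|quad p q r s a| + quad p q r s a * f a))
    + 8 * f 0 =
  2 * (hat f p + hat f q + hat f r + hat f s)
    + B * ((3 - (p + q + r + s == 0)%:R) * N - 8).
Proof.
move=> un fB.
have := sum_quad_norm un.
rewrite sum_hat4 [in X in _ -> _ = X](bigD1 0) //= [in X in X -> _](bigD1 0) //=.
rewrite quad0 ger0_norm ?ler0n //.
rewrite big_split /= -mulr_sumr => e.
have -> : (3 - (p + q + r + s == 0)%:R) * N =
  2 * (4 + \sum_(i | i != 0) `|quad p q r s i|) by rewrite e.
ring.
Qed.

Lemma four_rows_ge0 f (B : R) p q r s a :
  `|f a| <= B -> 0 <= B * `|quad p q r s a| + quad p q r s a * f a.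
Proof.
move=> fB; have : `|quad p q r s a * f a| <= B * `|quad p q r s a|.
  by rewrite normrM mulrC ler_wpM2r.
rewrite ler_norml => /andP[]; lra.
Qed.

(** The threshold: 3 N - 8 is 8 rho. *)
Lemma four_rows_le f (B : R) p q r s : uniq [:: p; q; r; s] ->
    0 <= B -> (forall a, a != 0 -> `|f a| <= B) ->
  8 * f 0 - B * (3 * N - 8) <= 2 * (hat f p + hat f q + hat f r + hat f s).
Proof.
move=> un B0 fB; have := four_rows un fB.
have : 0 <= \sum_(a | a != 0) (B * `|quad p q r s a| + quad p q r s a * f a).
  by apply: sumr_ge0 => a /fB; apply: four_rows_ge0.
have : 0 <= B * ((p + q + r + s == 0)%:R * N) by rewrite !mulr_ge0 ?order2E ?ler0n.
move: (\sum_(a | a != 0) _) (_ == 0)%:R N => S e n0; clear; lra.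
Qed.

(** Equality in the estimate forces every coordinate where the sum of the four
    characters is nonzero to be extremal. *)
Lemma four_tight f (B : R) p q r s : uniq [:: p; q; r; s] ->
    0 < B -> (forall a, a != 0 -> `|f a| <= B) ->
    B * (3 * N - 8) <= 8 * f 0 ->
    hat f p = 0 -> hat f q = 0 -> hat f r = 0 -> hat f s = 0 ->
  p + q + r + s != 0 /\
  forall a, a != 0 -> quad p q r s a * f a = - (B * `|quad p q r s a|).
Proof.
move=> un B0 fB le hp hq hr hs; have := four_rows un fB.
rewrite hp hq hr hs.
have F a : a != 0 -> 0 <= B * `|quad p q r s a| + quad p q r s a * f a.
  by move=> /fB; apply: four_rows_ge0.
have S0 := sumr_ge0 (index_enum _) F.
have BN0 : 0 < B * N by rewrite mulr_gt0 // order2E ltr0n expn_gt0.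
move: S0 le BN0; have [z|nz] := eqVneq (p + q + r + s) 0.
  rewrite [true%:R]mulr1n; move: (\sum_(a | a != 0) _) N => S n0 S0 le BN0 e.
  by exfalso; move: S0 le BN0 e; clear; lra.
rewrite [false%:R]mulr0n => S0 le BN0 e; split=> // a a0.
have /eqP : \sum_(a | a != 0) (B * `|quad p q r s a| + quad p q r s a * f a) = 0.
  by move: S0 le BN0 e; move: (\sum_(a | a != 0) _) N => S n0; clear; lra.
rewrite psumr_eq0 // => /allP/(_ a (mem_index_enum _)); rewrite a0 => /eqP; clear; lra.
Qed.

End FourRows.

Section ThreeSmallest.
Variables (d : Order.disp_t) (K : orderType d) (I : finType) (F : I -> K).

Lemma smallest (S : {pred I}) : (0 < #|S|)%N ->
  exists2 i, i \in S & forall j, j \in S -> (F i <= F j)%O.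
Proof.
move=> /card_gt0P[i0 i0S].
by case: (@Order.TotalTheory.arg_minP _ _ _ i0 (mem S) F i0S) => i; exists i.
Qed.

Lemma three_smallest : (2 < #|I|)%N ->
  exists p q r, [/\ uniq [:: p; q; r], (F p <= F q)%O, (F q <= F r)%O
    & forall s, uniq [:: p; q; r; s] -> (F r <= F s)%O].
Proof.
move=> I3.
have [p _ pm] : exists2 i, i \in predT & forall j, j \in predT -> (F i <= F j)%O.
  by apply: smallest; rewrite (leq_trans _ I3).
have c1 := cardC (pred1 p); rewrite card1 in c1.
have [|q qp qm] := @smallest (predC (pred1 p)).
  by rewrite -(ltn_add2l 1) c1 ltnW.
rewrite !inE in qp.
have c2 := cardC (pred2 p q); rewrite card2 eq_sym qp in c2.
have [|r rp rm] := @smallest (predC (pred2 p q)).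
  by rewrite -(ltn_add2l 2) c2.
rewrite !inE negb_or in rp; case/andP: rp => rp rq.
exists p, q, r; split.
- by rewrite /= !inE negb_or ![p == _]eq_sym [q == r]eq_sym qp rp rq.
- by apply: pm.
- by apply: qm; rewrite inE.
move=> s /=; rewrite !inE !negb_or => /and4P[/and3P[_ _ ps] /andP[_ qs] _ _].
by apply: rm; rewrite !inE negb_or ![s == _]eq_sym ps qs.
Qed.

End ThreeSmallest.

(** Enumerate A without B, then both, then B without A, then the rest: A, B and
    the whole set are intervals.  Any function is then the increment of its
    prefix sums, and sums over the three sets telescope. *)
Section IntervalOrder.
Variable (I : finType).

Lemma sum_segment (G : zmodType) (x0 : I) (F : I -> G) (s1 s2 s3 : seq I) :
  \sum_(i <- s2) F i =
    \sum_(size s1 <= j < size (s1 ++ s2)) F (nth x0 (s1 ++ s2 ++ s3) j).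
Proof.
rewrite size_cat (big_nth x0) -{1}[size s1]add0n big_addn addKn.
rewrite !big_nat; apply: eq_bigr => j /= js.
by rewrite nth_cat ltnNge leq_addl addnK nth_cat js.
Qed.

Lemma interval_order (A B : {set I}) : (0 < #|I|)%N ->
  exists pos : I -> nat, exists l1 h1 l2 h2 h3 : nat,
    forall G : zmodType,
      (forall P : nat -> G,
        [/\ \sum_(i in A) (P (pos i).+1 - P (pos i)) = P h1 - P l1,
            \sum_(i in B) (P (pos i).+1 - P (pos i)) = P h2 - P l2
          & \sum_i (P (pos i).+1 - P (pos i)) = P h3 - P 0%N]) /\
      (forall X : I -> G, exists P : nat -> G,
        forall i, P (pos i).+1 - P (pos i) = X i).
Proof.
move=> /card_gt0P[x0 _].
pose s1 := enum (A :\: B); pose s2 := enum (A :&: B).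
pose s3 := enum (B :\: A); pose s4 := enum (~: (A :|: B)).
pose s := s1 ++ s2 ++ s3 ++ s4.
have us : uniq s.
  rewrite /s !cat_uniq !enum_uniq /= !andbT.
  apply/and3P; split; apply/hasPn => i; rewrite ?mem_cat !mem_enum !inE;
  by case: (i \in A); case: (i \in B).
have ms i : i \in s.
  by rewrite /s !mem_cat !mem_enum !inE; case: (i \in A); case: (i \in B).
exists (index^~ s), 0%N, (size (s1 ++ s2)), (size s1), (size (s1 ++ s2 ++ s3)), (size s).
move=> G; split=> [P|X]; last first.
  exists (fun j => \sum_(0 <= i < j) X (nth x0 s i)) => i.
  by rewrite big_nat_recr //= [_ + X _]addrC addrK nth_index.
have seg t1 t2 t3 : s = t1 ++ t2 ++ t3 ->
    \sum_(i <- t2) (P (index i s).+1 - P (index i s)) =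
    P (size (t1 ++ t2)) - P (size t1).
  move=> st; rewrite (sum_segment x0 _ t1 t2 t3) -st -telescope_sumr; last first.
    by rewrite size_cat leq_addr.
  rewrite !big_nat; apply: eq_bigr => j /andP[_ js].
  by rewrite index_uniq // st catA size_cat (leq_trans js) ?leq_addr.
have su (S : {set I}) t : uniq t -> (t =i S) -> forall F : I -> G,
    \sum_(i in S) F i = \sum_(i <- t) F i.
  move=> ut tS F; rewrite [RHS]big_uniq //=.
  by apply: eq_bigl => i; rewrite tS.
split.
- rewrite (su _ (s1 ++ s2)) ?(seg [::] _ (s3 ++ s4)) ?/s ?catA //.
  + by move: us; rewrite /s catA cat_uniq => /andP[].
  + by move=> i; rewrite mem_cat !mem_enum !inE; case: (i \in A); case: (i \in B).
- rewrite (su _ (s2 ++ s3)) ?(seg s1 _ s4) ?/s ?catA //.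
  + by move: us; rewrite /s cat_uniq catA cat_uniq => /and4P[_ _].
  + by move=> i; rewrite mem_cat !mem_enum !inE; case: (i \in A); case: (i \in B).
- have -> : \sum_i (P (index i s).+1 - P (index i s)) =
     \sum_(i in [set: I]) (P (index i s).+1 - P (index i s)).
    by apply: eq_bigl => i; rewrite inE.
  rewrite (su _ s) // ?(seg [::] _ [::]) ?cats0 //.
  by move=> i; rewrite ms inE.
Qed.

End IntervalOrder.

(** * The truncated simplex and its integral vertices *)

(** Membership in the truncated simplex, in coordinates where the simplex is cut
    out by characters. *)
Definition in_poly (R : realDomainType) k (M B : R) (f : 'rV['F_2]_k -> R) :=
  [/\ f 0 = M, forall a, a != 0 -> `|f a| <= B & forall u, 0 <= hat f u].

(** No nonzero direction annihilates the tight constraints at [f]: the algebraic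
    form of being a vertex. *)
Definition rigid (R : realDomainType) k (B : R) (f : 'rV['F_2]_k -> R) :=
  forall w : 'rV['F_2]_k -> R, w 0 = 0 ->
    (forall a, a != 0 -> `|f a| = B -> w a = 0) ->
    (forall u, hat f u = 0 -> hat w u = 0) ->
  forall a, w a = 0.

Section Integral.
Variables (R : realType) (k : nat) (m n : nat).
Hypotheses (k3 : (3 < k)%N) (om : odd m) (on : odd n).
Local Notation V := 'rV['F_2]_k.
Local Notation chi := (@chi R k).
Local Notation N := (order2 R k).
Local Notation half x := ((x + n%:R) / 2).
Implicit Types (u v a b p q r s : V).

(** Flipping a coordinate preserves the lattice: [half] tests membership in
    n + 2 Z, and n is an integer. *)
Lemma half_int (e x : R) : e = 1 \/ e = -1 ->
  (half (e * x) \is a Num.int) = (half x \is a Num.int).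
Proof.
case=> ->; first by rewrite mul1r.
have h (y : R) : half (-1 * y) = n%:R - half y by field.
have nZ : n%:R \is a @Num.int R by rewrite rpred_nat.
apply/idP/idP => i; last by rewrite h rpredB.
by have := rpredB nZ i; rewrite h opprB addrC subrK.
Qed.

Lemma half_pm (x : R) : `|x| = n%:R -> half x \is a Num.int.
Proof.
have [_ ->|_ h] := ger0P x.
  have -> : half (n%:R : R) = n%:R by field.
  by rewrite rpred_nat.
have -> : half x = 0 by rewrite -h; field.
exact: rpred0.
Qed.

Lemma half_odd : half (m%:R : R) \is a Num.int.
Proof.
have e : (m + n)%N = ((m + n)./2).*2 by rewrite -[LHS]odd_double_half oddD om on.
by rewrite -natrD e -muln2 natrM mulfK ?rpred_nat ?pnatr_eq0.
Qed.

Variable f : V -> R.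
Hypotheses (fP : in_poly m%:R n%:R f) (fR : rigid n%:R f).
Hypothesis le_mn : n%:R * (3 * N - 8) <= 8 * m%:R.

Let f0 : f 0 = m%:R. Proof. by case: fP. Qed.
Let fB a : a != 0 -> `|f a| <= n%:R. Proof. by case: fP => _ + _; apply. Qed.
Let fH u : 0 <= hat f u. Proof. by case: fP. Qed.
Let n0 : 0 < n%:R :> R. Proof. by rewrite ltr0n odd_gt0. Qed.

Let tight4 p q r s : uniq [:: p; q; r; s] ->
    hat f p = 0 -> hat f q = 0 -> hat f r = 0 -> hat f s = 0 ->
  p + q + r + s != 0 /\
  forall a, a != 0 -> quad R p q r s a * f a = - (n%:R * `|quad R p q r s a|).
Proof. by move=> un; apply: four_tight => //; rewrite f0. Qed.

(** Only coordinates at which the four characters cancel can be off the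
    lattice. *)
Lemma tight4_quad p q r s a : uniq [:: p; q; r; s] ->
    hat f p = 0 -> hat f q = 0 -> hat f r = 0 -> hat f s = 0 ->
  a != 0 -> half (f a) \isn't a Num.int -> quad R p q r s a = 0.
Proof.
move=> un hp hq hr hs a0 fa; have [_ /(_ a a0) e] := tight4 un hp hq hr hs.
apply/eqP; apply: contraNT fa => S0; apply: half_pm.
apply: (@mulfI _ `|quad R p q r s a|); first by rewrite normr_eq0.
by rewrite -normrM e normrN normrM normr_id mulrC ger0_norm // ltW.
Qed.

(** With a fifth tight row, every four of the five would have to cancel. *)
Lemma tight4_all p q r s a : uniq [:: p; q; r; s] ->
    hat f p = 0 -> hat f q = 0 -> hat f r = 0 -> hat f s = 0 ->
    a != 0 -> half (f a) \isn't a Num.int ->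
  forall u, hat f u = 0 -> u \in [:: p; q; r; s].
Proof.
move=> un hp hq hr hs a0 fa u hu; apply/negPn/negP => up.
have Q p' q' r' s' un' hp' hq' hr' hs' :=
  @tight4_quad p' q' r' s' a un' hp' hq' hr' hs' a0 fa.
have e1 := Q _ _ _ _ un hp hq hr hs.
move: un up; rewrite /= !inE !negb_or.
move=> /and4P[/and3P[pq pr ps] /andP[qr qs] rs _] /and4P[up uq ur us].
have e2 : quad R u q r s a = 0 by apply: Q => //=; rewrite !inE !negb_or uq ur us qr qs rs.
have e3 : quad R p u r s a = 0.
  by apply: Q => //=; rewrite !inE !negb_or eq_sym up pr ps ur us rs.
have e4 : quad R p q u s a = 0.
  apply: Q => //=; rewrite !inE !negb_or [p == u]eq_sym [q == u]eq_sym.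
  by rewrite pq up ps uq qs us.
exact: five_signs (chi_sign R s a) (chi_sign R u a) e1 e2 e3 e4.
Qed.

(** On the cell E of the coordinates with the same signs as [a], the four
    equations give a sum zero.  As E has even size N/8, it contains a second
    coordinate off the lattice, and moving the two against each other keeps the
    four rows tight. *)
Lemma tight4_split p q r s a : uniq [:: p; q; r; s] ->
    hat f p = 0 -> hat f q = 0 -> hat f r = 0 -> hat f s = 0 ->
    (forall u, hat f u = 0 -> u \in [:: p; q; r; s]) ->
    a != 0 -> chi q a = chi p a -> chi r a = - chi p a -> chi s a = - chi p a ->
  half (f a) \is a Num.int.
Proof.
move=> un hp hq hr hs T a0 qa ra sa.
have [pqrs Sf] := tight4 un hp hq hr hs.
pose E := [pred b | [&& chi q b == chi p b, chi r b == - chi p b & chi s b == - chi p b]].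
have aE : a \in E by rewrite inE qa ra sa !eqxx.
have E0 b : b \in E -> b != 0.
  by apply: contraTneq => ->; rewrite inE !chi0r sign_neq !andbF.
have EP b : (b \in E)%:R * 8 = 1 + chi p b * chi q b + chi r b * chi s b
    + chi (p + q + r + s) b - chi p b * chi r b - chi q b * chi r b
    - chi p b * chi s b - chi q b * chi s b.
  by rewrite inE !chiDl; apply: split_signs; apply: chi_sign.
have EF b : (b \in E)%:R * (4 * (chi p b * f b)) =
   (chi p b * f b + chi q b * f b - chi r b * f b - chi s b * f b)
   + n%:R * (chi p b * chi q b - chi r b * chi s b).
  have [->|b0] := eqVneq b 0.
    by rewrite inE !chi0r sign_neq !andbF [false%:R]mulr0n; ring.
  by rewrite inE; apply: split_value (Sf b b0); apply: chi_sign.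
move: un; rewrite /= !inE !negb_or => /and4P[/and3P[pq pr ps] /andP[qr qs] rs _].
have cE : \sum_(b in E) 1 = 2 * (2 ^ (k - 4))%:R :> R.
  have e : \sum_b (b \in E)%:R * 8 = N :> R.
    under eq_bigr do rewrite EP.
    rewrite !sumrB !big_split /= !sum_chiM !sum_chi sumr_const card_F2_row.
    rewrite (negPf pq) (negPf pr) (negPf ps) (negPf qr) (negPf qs) (negPf rs) (negPf pqrs).
    by rewrite !mul0r !addr0 !subr0 order2E.
  apply: (@mulIf _ 8); first by rewrite pnatr_eq0.
  rewrite mulrAC -natrM -(order16 _ k3) -e -mulr_suml big_mkcond; congr (_ * _).
  by apply: eq_bigr => b _; case: ifP.
have sE : \sum_(b in E) chi p b * f b = 0.
  have e : \sum_b (b \in E)%:R * (4 * (chi p b * f b)) = 0.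
    under eq_bigr do rewrite EF.
    rewrite big_split /= -mulr_sumr !sumrB !sum_chiM (negPf pq) (negPf rs) big_split /=.
    by rewrite -!/(hat f _) hp hq hr hs !(mul0r, subr0, mulr0, addr0).
  apply: (@mulfI _ 4); first by rewrite pnatr_eq0.
  rewrite mulr0 -[RHS]e mulr_sumr big_mkcond /=.
  by apply: eq_bigr => b _; case: ifP; rewrite ?mul1r ?mul0r.
have sX : \sum_(b in E) half (chi p b * f b) \is a Num.int.
  rewrite -mulr_suml big_split /= sE add0r.
  rewrite (eq_bigr (fun b => n%:R * 1)) => [|b _]; last by rewrite mulr1.
  rewrite -mulr_sumr cE mulrCA [2 * _]mulrC mulfK ?pnatr_eq0 //.
  by rewrite rpredM ?rpred_nat.
apply: contraT => fa.
(* The values over E sum to an integer, so not just one of them is fractional. *)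
have [b /and3P[bE ba fb]] : exists b, [&& b \in E, b != a & half (f b) \isn't a Num.int].
  apply/existsP; apply: contraNT fa; rewrite negb_exists => /forallP h.
  rewrite -(half_int _ (chi_sign R p a)).
  move: sX; rewrite (bigD1 a) //= rpredDr // rpred_sum // => b /andP[bE ba].
  by rewrite (half_int _ (chi_sign R p b)); move: (h b); rewrite bE ba /= negbK.
have b0 := E0 b bE.
pose w c := (c == a)%:R * chi p a - (c == b)%:R * chi p b.
have hw u : hat w u = chi u a * chi p a - chi u b * chi p b.
  rewrite /hat /w; under eq_bigr do rewrite mulrBr; rewrite sumrB.
  congr (_ - _); [rewrite (bigD1 a) //= | rewrite (bigD1 b) //=].
    rewrite eqxx mul1r big1 ?addr0 // => c /negPf ->; by rewrite mul0r mulr0.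
  rewrite eqxx mul1r big1 ?addr0 // => c /negPf ->; by rewrite mul0r mulr0.
have wa : w a = chi p a by rewrite /w eqxx [a == b]eq_sym (negPf ba) mul1r mul0r subr0.
have : w a = 0.
  apply: fR.
  - by rewrite /w ![0 == _]eq_sym (negPf a0) (negPf b0) !mul0r subr0.
  - move=> c _ /half_pm fc; rewrite /w.
    have /negPf -> : c != a by apply: contraTneq fc => ->.
    have /negPf -> : c != b by apply: contraTneq fc => ->.
    by rewrite !mul0r subr0.
  move=> u /T; move: bE; rewrite hw !inE => /and3P[/eqP qb /eqP rb /eqP sb].
  move=> /or4P[] /eqP ->; rewrite ?qa ?ra ?sa ?qb ?rb ?sb ?mulNr !chi_sq; ring.
rewrite wa; by case: (chi_sign R p a) => -> /eqP; rewrite ?oppr_eq0 oner_eq0.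
Qed.

(** Cancelling signs split the four rows into two pairs, in one of three ways. *)
Lemma tight4_integral p q r s : uniq [:: p; q; r; s] ->
    hat f p = 0 -> hat f q = 0 -> hat f r = 0 -> hat f s = 0 ->
  forall a, a != 0 -> half (f a) \is a Num.int.
Proof.
move=> un hp hq hr hs a a0; apply: contraT => fa.
have T := tight4_all un hp hq hr hs a0 fa.
have S0 := tight4_quad un hp hq hr hs a0 fa.
have P (s1 s2 : seq V) : perm_eq s1 s2 -> (forall u, hat f u = 0 -> u \in s2) ->
    (forall u, hat f u = 0 -> u \in s1).
  by move=> /perm_mem e h u /h; rewrite e.
have pr : perm_eq [:: p; r; q; s] [:: p; q; r; s] by rewrite perm_cons (perm_catCA [:: r] [:: q]).
have ps : perm_eq [:: p; s; q; r] [:: p; q; r; s] by rewrite perm_cons (perm_catC [:: s] [:: q; r]).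
apply: contraNT fa => _.
case: (four_signs (chi_sign R p a) (chi_sign R q a) (chi_sign R r a) (chi_sign R s a) S0)
  => -[e1 e2 e3].
- exact: (@tight4_split p q r s).
- by apply: (@tight4_split p r q s) => //; [rewrite (perm_uniq pr)|apply: P pr T].
- by apply: (@tight4_split p s q r) => //; [rewrite (perm_uniq ps)|apply: P ps T].
Qed.

(** Order the coordinates so that the tight equations bound intervals of them.
    The prefix sums at the two ends of such an interval then differ by an
    integer, so the indicator [W] of the class modulo integers of one prefix sum
    is constant across them: its increments form a direction annihilating all
    tight constraints.  It does not vanish at [a] if [a] is off the lattice.
    The comparison of the transforms ensures that a tight row makes the smaller
    ones tight, so that differences with [p] may be used. *)
Lemma three_integral p q r :
    uniq [:: p; q; r] -> hat f p <= hat f q -> hat f q <= hat f r ->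
    (forall u, hat f u = 0 -> u \in [:: p; q; r]) ->
  forall a, a != 0 -> half (f a) \is a Num.int.
Proof.
move=> un pq qr T a a0; apply: contraT => fa.
pose A u := opposite R p u.
have cV : (0 < #|{: V}|)%N by rewrite card_F2_row expn_gt0.
have [pos [l1 [h1 [l2 [h2 [h3 seg]]]]]] := interval_order (A q) (A r) cV.
have [/(_ _) sP exP] := seg R.
have [P PX] := exP (fun b => half (chi p b * f b)).
(* Centred at the upper end of [a], W takes the values 1 and 0 around [a]. *)
pose W j : R := (P j - P (pos a).+1 \is a Num.int)%:R.
have WE i j : P i - P j \is a Num.int -> W i = W j.
  move=> ij; rewrite /W -(subrK (P j) (P i)) -addrA; congr (_%:R).
  by rewrite rpredDl.
pose w b := chi p b * (W (pos b).+1 - W (pos b)).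
have wint b : half (f b) \is a Num.int -> w b = 0.
  rewrite -(half_int _ (chi_sign R p b)) => i.
  by rewrite /w (WE (pos b).+1 (pos b)) ?PX // subrr mulr0.
have wa : w a = chi p a.
  rewrite /w /W subrr rpred0 -[_ - P _.+1]opprB rpredN PX.
  by rewrite (half_int _ (chi_sign R p a)) (negPf fa) subr0 mulr1.
have [SA SB ST] := sP P; have [WA WB WT] := sP W.
have pM (g : V -> R) u : \sum_(b in A u) chi p b * g b = (hat g p - hat g u) / 2.
  by rewrite -sum_opposite mulrC mulKf ?pnatr_eq0.
have hwp : hat w p = W h3 - W 0%N.
  by rewrite -WT; apply: eq_bigr => b _; rewrite /w mulrA chi_sq mul1r.
have hwu u : \sum_(b in A u) (W (pos b).+1 - W (pos b)) = (hat w p - hat w u) / 2.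
  by rewrite -pM; apply: eq_bigr => b _; rewrite /w mulrA chi_sq mul1r.
have Nh : n%:R * N / 2 \is a Num.int.
  by rewrite (order16 _ k3) (_ : _ / 2 = n%:R * (8 * (2 ^ (k - 4))%:R)); [rewrite !rpredM ?rpred_nat|field].
have tp : hat f p = 0 -> hat w p = 0.
  move=> hp; rewrite hwp (WE h3 0%N) ?subrr // -ST.
  under eq_bigr do rewrite PX.
  rewrite -mulr_suml big_split /= -/(hat f p) hp sumr_const card_F2_row add0r.
  by rewrite -[n%:R *+ _]mulr_natr -order2E.
have tu u l h : u != p -> (forall g : nat -> R,
     \sum_(b in A u) (g (pos b).+1 - g (pos b)) = g h - g l) ->
   hat f p = 0 -> hat f u = 0 -> hat w u = 0.
  move=> up gl hp hu; suff : W h - W l = 0.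
    by rewrite -gl hwu tp // => /eqP; rewrite mulf_eq0 invr_eq0 pnatr_eq0 orbF sub0r oppr_eq0 => /eqP.
  rewrite (WE h l) ?subrr // -gl; under eq_bigr do rewrite PX.
  rewrite -mulr_suml big_split /= pM hp hu subrr mul0r add0r.
  have -> : \sum_(b in A u) (n%:R : R) = n%:R * (8 * (2 ^ (k - 4))%:R).
    rewrite (eq_bigr (fun b => n%:R * 1)) => [|b _]; last by rewrite mulr1.
    rewrite -mulr_sumr; congr (_ * _); apply: (@mulfI _ 2); first by rewrite pnatr_eq0.
    by rewrite card_opposite // (order16 _ k3) mulrA -[2 * 8]natrM.
  rewrite (_ : _ / 2 = n%:R * (4 * (2 ^ (k - 4))%:R)); last by field.
  by rewrite !rpredM ?rpred_nat.
have : w a = 0.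
  apply: fR.
  - by apply: wint; rewrite f0 half_odd.
  - by move=> b _ /half_pm; apply: wint.
  move=> u hu; have uT := T u hu; move: uT hu; rewrite !inE.
  move: un; rewrite /= !inE !negb_or => /and3P[/andP[npq npr] nqr _].
  have le0 v v' : hat f v <= hat f v' -> hat f v' = 0 -> hat f v = 0.
    by move=> + v0; rewrite v0 => vv; apply/eqP; rewrite eq_le vv fH.
  move=> /or3P[] /eqP -> h; first exact: tp.
    apply: (tu _ l1 h1) => //; first by rewrite eq_sym.
    - by move=> g; case: (sP g).
    - exact: le0 h.
  apply: (tu _ l2 h2) => //; first by rewrite eq_sym.
  - by move=> g; case: (sP g).
  - exact: le0 (le_trans pq qr) h.
rewrite wa; by case: (chi_sign R p a) => -> /eqP; rewrite ?oppr_eq0 oner_eq0.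
Qed.

Lemma rigid_integral a : a != 0 -> half (f a) \is a Num.int.
Proof.
have [|p [q [r [un pq qr rm]]]] := @three_smallest _ R V (hat f).
  by rewrite card_F2_row (leq_trans _ (leq_pexp2l (isT : 0 < 2)%N k3)).
have [s /andP[us hs]|no] := pickP [pred s | uniq [:: p; q; r; s] & hat f s == 0].
  have le0 v : hat f v <= hat f s -> hat f v = 0.
    by move=> vv; apply/eqP; rewrite eq_le fH -(eqP hs) vv.
  have rs := rm _ us.
  apply: (tight4_integral us); last exact/eqP.
  - by apply: le0; rewrite (le_trans pq) // (le_trans qr).
  - by apply: le0; rewrite (le_trans qr).
  - exact: le0.
apply: (three_integral un pq qr) => u hu; move: (no u); rewrite /= hu eqxx andbT.
move: un; rewrite /= !inE !negb_or => /and3P[/andP[-> ->] -> _] /=.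
by rewrite ![_ == u]eq_sym; case: eqP => // _; case: eqP => // _; case: eqP.
Qed.

End Integral.

(** * Rounding by floor division *)

Section Hermite.

(** Rounding prefix sums to multiples of [r] preserves integral bounds on
    differences, both for the piece and for what remains. *)
Lemma fdiv_lower (r u v i B : int) : 0 < r -> r * B <= v - u ->
  B <= ((v + i) %/ r)%Z - ((u + i) %/ r)%Z <= B + (v - u - r * B).
Proof.
move=> r0 le.
have := divz_eq (v + i) r; have := divz_eq (u + i) r.
have := ltz_pmod (v + i) r0; have := ltz_pmod (u + i) r0.
have := modz_ge0 (v + i) (lt0r_neq0 r0); have := modz_ge0 (u + i) (lt0r_neq0 r0).
move: ((v + i) %/ r)%Z ((u + i) %/ r)%Z ((v + i) %% r)%Z ((u + i) %% r)%Z.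
move=> e1 e2 m1 m2 *; apply/andP; split.
  rewrite leNgt; apply/negP => h.
  have : 0 <= r * (B - 1 - (e1 - e2)) by apply: mulr_ge0; lia.
  lia.
rewrite leNgt; apply/negP => h.
have : 0 <= r * (e1 - e2 - B - (v - u - r * B) - 1) by apply: mulr_ge0; lia.
have : 0 <= (r - 1) * (v - u - r * B) by apply: mulr_ge0; lia.
lia.
Qed.

Lemma fdiv_upper (r u v i B : int) : 0 < r -> v - u <= r * B ->
  B - (r * B - (v - u)) <= ((v + i) %/ r)%Z - ((u + i) %/ r)%Z <= B.
Proof.
move=> r0 le; have := @fdiv_lower r v u i (- B) r0.
by rewrite mulrN => /(_ _)/andP[|]; lia.
Qed.

(** Hermite's identity: the [r] shifted roundings of [x / r] add up to [x]. *)
Lemma sum_fdiv (r : nat) (x : int) : (0 < r)%N ->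
  \sum_(i < r) ((x + i%:Z) %/ r%:Z)%Z = x.
Proof.
move=> r0; have rz : r%:Z != 0 by rewrite intS_neq0 || by lia.
have nat_case (y : nat) : \sum_(i < r) (((y + i) %/ r)%N)%:Z = y%:Z.
  elim: y => [|y IH].
    by rewrite big1 // => i _; rewrite add0n divn_small.
  rewrite -addn1 PoszD -[in RHS]IH.
  rewrite -!(big_mkord xpredT (fun i => ((_ + i) %/ r)%N%:Z)).
  case: r r0 {rz IH} => // r _.
  rewrite big_nat_recr //= [in RHS]big_nat_recl //= addrC [RHS]addrAC; congr (_ + _).
    by rewrite addn0 -addnA add1n divnDr // divnn /= PoszD.
  by apply: eq_bigr => i _; rewrite addnAC addn1 addnS.
rewrite [in RHS](divz_eq x r).
have [y xy] : exists y : nat, (x %% r%:Z)%Z = y.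
  by have := modz_ge0 x rz; case: (x %% r)%Z => // y _; exists y.
rewrite xy -[in RHS](nat_case y) mulrC.
under eq_bigr => i _ do rewrite [in X in (X + _)%R](divz_eq x r) xy -addrA divzMDl //.
rewrite big_split /= sumr_const card_ord -mulr_natl.
rewrite natz; congr (_ + _); apply: eq_bigr => i _; exact: divz_nat.
Qed.

(** If h is the residue of the increment, each error is -h or r - h and the errors add
    up to zero, so their absolute values add up to 2 h (r - h) <= r^2 / 2.  On the two
    possible values the absolute value is an affine function of the error, which
    the proof sums. *)
Lemma fdiv_error (r : nat) (u v : int) : (0 < r)%N ->
  2 * (\sum_(i < r) `|r%:Z * (((v + i%:Z) %/ r%:Z)%Z - ((u + i%:Z) %/ r%:Z)%Z) - (v - u)|)
    <= r%:Z ^+ 2.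
Proof.
move=> r0; have rz : 0 < r%:Z by lia.
set D := v - u.
have := divz_eq D r; have := ltz_pmod D rz; have := modz_ge0 D (lt0r_neq0 rz).
move: (D %/ r)%Z (D %% r)%Z => c h h0 hr De.
rewrite -(ler_pM2l rz).
pose d (i : 'I_r) := r%:Z * (((v + i%:Z) %/ r%:Z)%Z - ((u + i%:Z) %/ r%:Z)%Z) - D.
have sd : \sum_i d i = 0.
  rewrite sumrB -mulr_sumr sumrB !sum_fdiv // sumr_const card_ord -mulr_natl.
  by rewrite /D; ring.
have bd i : 2 * r%:Z * `|d i| <= 2 * (r%:Z - 2 * h) * d i + r%:Z ^+ 2.
  have h1 : r%:Z * c <= v - u by lia.
  have h2 : v - u <= r%:Z * (c + 1) by lia.
  have /andP[b1 b2] := fdiv_lower i%:Z rz h1.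
  have /andP[b3 b4] := fdiv_upper i%:Z rz h2.
  have sq : 0 <= (r%:Z - 2 * h) ^+ 2 by apply: sqr_ge0.
  have [e|e] : d i = - h \/ d i = r%:Z - h.
  - rewrite /d; move: b1 b2 b3 b4; move: ((_ %/ _)%Z - _) => e b1 b2 b3 b4.
    have [->|->] : e = c \/ e = c + 1 by lia.
      by left; lia.
    by right; lia.
  - by rewrite e ler0_norm; lia.
  by rewrite e ger0_norm; lia.
have : \sum_i 2 * r%:Z * `|d i| <= \sum_i (2 * (r%:Z - 2 * h) * d i + r%:Z ^+ 2).
  by apply: ler_sum.
rewrite big_split /= -!mulr_sumr sd mulr0 add0r sumr_const card_ord [_ *+ r in X in X -> _]pmulrn mulrzz.
by rewrite [r%:Z * (2 * _)]mulrCA mulrA [r%:Z * _ ^+ 2]mulrC.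
Qed.

End Hermite.

(** * Splitting lattice points *)

Section Normal.
Variables (k m n : nat).
Hypotheses (k3 : (3 < k)%N) (om : odd m) (on : odd n).
Local Notation V := 'rV['F_2]_k.
Local Notation chi := (@chi int k).
Local Notation N := (order2 int k).
Local Notation K := ((2 ^ (k - 4))%:R : int).
Hypothesis le_mn : n%:Z * (3 * N - 8) + 8 * (N - 2) <= 8 * m%:Z.
Implicit Types (F y : V -> int) (u a b p q : V).

Definition lattice_poly (r : nat) F :=
  in_poly (r%:Z * m%:Z) (r%:Z * n%:Z) F /\
  forall a, exists z : int, F a = r%:Z * n%:Z + 2 * z.

Let NK : N = 16 * K. Proof. exact: order16. Qed.

(** The coordinates counted from 0, in the sign convention of the row [p]. *)
Lemma half_chi r F : lattice_poly r F -> forall p a,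
  exists x : int, 2 * x = chi p a * F a + r%:Z * n%:Z.
Proof.
move=> [_ Fz] p a; have [z ->] := Fz a.
case: (chi_sign int p a) => ->; [exists (r%:Z * n%:Z + z) | exists (- z)]; ring.
Qed.

Lemma hat_error (e : V -> int) u : e 0 = 0 ->
  `|hat e u| <= \sum_(a | a != 0) `|e a|.
Proof.
move=> e0; rewrite /hat (bigD1 0) //= e0 mulr0 add0r.
apply: le_trans (ler_norm_sum _ _ _) _; apply: ler_sum => a _.
by rewrite normrM; case: (chi_sign int u a) => ->; rewrite ?normrN normr1 mul1r.
Qed.

(** By averaging, one of the [r] roundings is close to the scaled point in the
    l1 norm.  The coordinate 0 is left out: there the rounding is exact, and
    this saves the unit that makes the parity argument work. *)
Lemma average_error (r : nat) (P : nat -> int) (pos : V -> nat) : (0 < r)%N ->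
  exists i : 'I_r, 2 * (\sum_(a | a != 0)
    `|r%:Z * (((P (pos a).+1 + i%:Z) %/ r%:Z)%Z - ((P (pos a) + i%:Z) %/ r%:Z)%Z)
      - (P (pos a).+1 - P (pos a))|) <= r%:Z * (N - 1).
Proof.
move=> r0; pose G (i : 'I_r) := 2 * (\sum_(a | a != 0)
    `|r%:Z * (((P (pos a).+1 + i%:Z) %/ r%:Z)%Z - ((P (pos a) + i%:Z) %/ r%:Z)%Z)
      - (P (pos a).+1 - P (pos a))|).
have [i Gi|no] := pickP (fun i => G i <= r%:Z * (N - 1)); first by exists i.
have up : \sum_i G i <= r%:Z ^+ 2 * (N - 1).
  rewrite -mulr_sumr exchange_big mulr_sumr /=.
  have -> : N - 1 = \sum_(a : V | a != 0) 1.
    have := sum_chi int (0 : V); rewrite eqxx mul1r => <-.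
    rewrite (bigD1 0) //= chi0l addrAC subrr add0r.
    by apply: eq_bigr => a _; rewrite chi0l.
  rewrite mulr_sumr; apply: ler_sum => a _; rewrite mulr1.
  exact: fdiv_error.
have : \sum_(i < r) (r%:Z * (N - 1) + 1) <= \sum_i G i.
  by apply: ler_sum => i _; move: (no i) => /negbT; rewrite -ltNge -lezD1.
rewrite sumr_const card_ord [_ *+ r in X in X -> _]pmulrn mulrzz => dn; exfalso.
move: up dn r0; rewrite expr2; move: (\sum_i G i) N => S x; clear; lia.
Qed.

(** The piece [y] is the rounding with small l1 error.  The rows [p], [q], [s]
    are handled by exact rounding of interval sums, the other rows by the
    error bound and parity. *)
Lemma split_off r F : (1 < r)%N -> lattice_poly r F ->
  exists y, lattice_poly 1 y /\ lattice_poly r.-1 (fun a => F a - y a).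
Proof.
move=> r1 FP; have [[F0 FB FH] Fz] := FP.
have [|p [q [s [un pq qs sm]]]] := @three_smallest _ int V (hat F).
  by rewrite card_F2_row (leq_trans _ (leq_pexp2l (isT : 0 < 2)%N k3)).
have cV : (0 < #|{: V}|)%N by rewrite card_F2_row expn_gt0.
have [pos [l1 [h1 [l2 [h2 [h3 seg]]]]]] :=
  interval_order (opposite int p q) (opposite int p s) cV.
have [sP exP] := seg int.
have [X XE] := fin_all_exists (half_chi FP p).
have [P PX] := exP X.
have rN : (0 < r)%N by apply: ltnW.
have [i err] := average_error P pos rN.
have r0 : 0 < r%:Z by lia.
pose fl j := ((P j + i%:Z) %/ r%:Z)%Z.
pose Y a := fl (pos a).+1 - fl (pos a).
have lo a B : r%:Z * B <= X a -> B <= Y a <= B + (X a - r%:Z * B).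
  by rewrite -PX; apply: fdiv_lower.
have hi a B : X a <= r%:Z * B -> B - (r%:Z * B - X a) <= Y a <= B.
  by rewrite -PX; apply: fdiv_upper.
pose y a := chi p a * (2 * Y a - n%:Z).
have Fy a : F a = chi p a * (2 * X a - r%:Z * n%:Z).
  by rewrite XE addrK mulrA chi_sq mul1r.
(* X 0 is a multiple of r, so every rounding of it is exact. *)
have [M ME] : exists M : int, 2 * M = m%:Z + n%:Z.
  by exists (((m + n)./2)%N : int); move: om on; lia.
have X0 : X 0 = r%:Z * M.
  by have := XE 0; rewrite chi0r F0; move: ME; clear; lia.
have Y0 : Y 0 = M.
  have /andP[] : M <= Y 0 <= M + (X 0 - r%:Z * M) by apply: lo; rewrite X0.
  by rewrite X0; clear; lia.
have y0 : y 0 = m%:Z by rewrite /y chi0r Y0; lia.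
have XB a : a != 0 -> 0 <= X a <= r%:Z * n%:Z.
  move=> /FB; have := XE a; move: (r%:Z * n%:Z) => c.
  by case: (chi_sign int p a) => ->; lia.
have YB a : a != 0 -> 0 <= Y a <= n%:Z /\ 0 <= X a - Y a <= (r%:Z - 1) * n%:Z.
  move=> /XB /andP[x1 x2].
  have {x1}/andP[] : 0 <= Y a <= 0 + (X a - r%:Z * 0) by apply: lo; rewrite mulr0.
  by have /andP[] := hi a n%:Z x2; rewrite mulr0; clear; lia.
have yz a : exists z : int, y a = 1%:Z * n%:Z + 2 * z.
  rewrite /y; case: (chi_sign int p a) => ->; [exists (Y a - n%:Z)|exists (- Y a)]; lia.
have [_ _ ST] := sP P; have [_ _ ST'] := sP fl.
have hatX : 2 * (\sum_a X a) = hat F p + r%:Z * n%:Z * N.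
  rewrite mulr_sumr; under eq_bigr do rewrite XE.
  rewrite big_split /= sumr_const card_F2_row.
  by rewrite -[_ *+ (2 ^ k)]mulr_natr -order2E.
have hatY : hat y p = 2 * (\sum_a Y a) - n%:Z * N.
  rewrite /hat; under eq_bigr do rewrite /y mulrA chi_sq mul1r.
  rewrite sumrB -mulr_sumr sumr_const card_F2_row.
  by rewrite -[_ *+ (2 ^ k)]mulr_natr -order2E.
have yp : 0 <= hat y p <= hat F p.
  have := @fdiv_lower r (P 0%N) (P h3) i (8 * n%:Z * K) r0.
  rewrite -/(fl _) -/(fl _) -ST -ST'; under eq_bigr do rewrite PX.
  rewrite -/(\sum_a Y a) hatY; have := FH p; move: hatX; rewrite NK.
  move: (\sum_a X a) (\sum_a Y a) => sX sY; move: (hat F p) => x.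
  move: (n%:Z) K => c d; clear -r0.
  move=> e1 e2 h; have /h/andP[]: r%:Z * (8 * c * d) <= sX by lia.
  lia.
have yu u l h : u != p -> hat F p <= hat F u ->
    (forall g : nat -> int,
     \sum_(b in opposite int p u) (g (pos b).+1 - g (pos b)) = g h - g l) ->
    0 <= hat y u <= hat F u.
  move=> up pu gl.
  have := @fdiv_upper r (P l) (P h) i (4 * n%:Z * K) r0.
  rewrite -/(fl _) -/(fl _) -!gl; under eq_bigr do rewrite PX.
  rewrite -/(Y _).
  have := sum_opposite F p u; have := sum_opposite y p u.
  have := card_opposite int up; rewrite NK.
  have -> : \sum_(b in opposite int p u) chi p b * F b =
     2 * (\sum_(b in opposite int p u) X b)
     - r%:Z * n%:Z * (\sum_(b in opposite int p u) 1).
    rewrite !mulr_sumr -sumrB; apply: eq_bigr => b _.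
    by rewrite Fy mulrA chi_sq mul1r mulr1.
  have -> : \sum_(b in opposite int p u) chi p b * y b =
     2 * (\sum_(b in opposite int p u) Y b)
     - n%:Z * (\sum_(b in opposite int p u) 1).
    rewrite !mulr_sumr -sumrB; apply: eq_bigr => b _.
    by rewrite /y mulrA chi_sq mul1r mulr1.
  rewrite -/(\sum_(b in opposite int p u) Y b).
  move: (\sum_(b in opposite int p u) X b) (\sum_(b in opposite int p u) Y b).
  move: (\sum_(b in opposite int p u) 1) yp pu.
  move: (hat F p) (hat F u) (hat y p) (hat y u) n%:Z K => a1 a2 a3 a4 c d S.
  move=> /andP[b1 b2] pu sX sY SE e1 e2 e3.
  have {}SE : S = 8 * d by lia.
  subst S.
  clear -r0 b1 b2 pu e1 e2 e3.
  have /e3/andP[] : sX <= r%:Z * (4 * c * d) by lia.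
  lia.
have yo u : uniq [:: p; q; s; u] -> 0 <= hat y u <= hat F u.
  move=> un4; have Fu := sm _ un4.
  have rn0 : 0 <= r%:Z * n%:Z by [].
  have := four_rows_le un4 rn0 FB; rewrite F0 => big.
  have {big} big : r%:Z * (N - 2) <= hat F u.
    have : 0 <= r%:Z * (8 * m%:Z - (n%:Z * (3 * N - 8) + 8 * (N - 2))).
      by apply: mulr_ge0 => //; rewrite subr_ge0.
    move: big; have := le_trans pq qs; move: pq qs Fu.
    move: (hat F p) (hat F q) (hat F s) (hat F u) N => x1 x2 x3 x4 c.
    by clear; lia.
  have er : `|r%:Z * hat y u - hat F u| <= r%:Z * (N - 1).
    have <- : hat (fun a => r%:Z * y a - F a) u = r%:Z * hat y u - hat F u.
      by rewrite hatB hatZ.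
    apply: le_trans (hat_error _ _) _; first by rewrite y0 F0 subrr.
    apply: le_trans err; rewrite mulr_sumr; apply: ler_sum => a _.
    rewrite PX -/(fl _) -/(fl _) -/(Y a) /y Fy.
    have -> : r%:Z * (chi p a * (2 * Y a - n%:Z)) - chi p a * (2 * X a - r%:Z * n%:Z)
      = chi p a * (2 * (r%:Z * Y a - X a)) by ring.
    by rewrite normrM; case: (chi_sign int p a) => ->; rewrite ?normrN normr1 mul1r normrM.
  have even (g : V -> int) (G : V -> int) (c : int) :
      (forall a, g a = chi p a * (2 * G a - c)) -> exists z, hat g u = 2 * z.
    move=> gG; exists (\sum_a chi u a * chi p a * G a).
    rewrite /hat (eq_bigr (fun a => 2 * (chi u a * chi p a * G a) - chi u a * chi p a * c)).
      rewrite sumrB -mulr_sumr -mulr_suml sum_chiM.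
      move: un4; rewrite /= !inE !negb_or [p == u]eq_sym.
      by move=> /and4P[/and3P[_ _ /negPf ->] _ _ _]; rewrite !mul0r subr0.
    by move=> a _; rewrite gG; ring.
  have [z1 e1] := even y Y n%:Z (fun a => erefl).
  have [z2 e2] := even F X _ Fy.
  move: (FH u) er big; rewrite e1 e2 ler_norml => h /andP[er1 er2] big.
  (* The two transforms are even, and the error bound leaves a gap below 2. *)
  have k0 : 0 <= (r%:Z - 2) * z2 by apply: mulr_ge0; lia.
  move: er1 er2 big k0 r0; move: N r%:Z => c t; clear => er1 er2 big k0 r0.
  apply/andP; split; rewrite leNgt; apply/negP => lt.
    have : 0 <= t * (- 1 - z1) by apply: mulr_ge0; lia.
    by lia.
  have : 0 <= t * (z1 - z2 - 1) by apply: mulr_ge0; lia.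
  by lia.
have yH u : 0 <= hat y u <= hat F u.
  have [->|up] := eqVneq u p; first exact: yp.
  have [e|uq] := eqVneq u q.
    by apply: (yu u l1 h1) => //; rewrite e // => g; case: (sP g).
  have [e|us] := eqVneq u s.
    apply: (yu u l2 h2) => //; rewrite e ?(le_trans pq qs) // => g; by case: (sP g).
  apply: yo; move: un; rewrite /= !inE !negb_or ![_ == u]eq_sym up uq us.
  by move=> /and3P[/andP[-> ->] -> _].
exists y; split; split; last 1 first.
- move=> a; have [z1 ->] := yz a; have [z2 ->] := Fz a; exists (z2 - z1).
  by rewrite -subn1 -subzn // ; ring.
- split=> [|a a0|u]; rewrite ?mul1r //; last by case/andP: (yH u).
  rewrite /y normrM; have [] := YB a a0.
  by case: (chi_sign int p a) => -> + _; rewrite ?normrN normr1 mul1r ler_norml; clear; lia.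
- exact: yz.
have rE : r.-1%:Z = r%:Z - 1 by rewrite -subn1 -subzn.
split=> [|a a0|u]; rewrite ?rE.
- by rewrite F0 y0; ring.
- have -> : F a - y a = chi p a * (2 * (X a - Y a) - (r%:Z - 1) * n%:Z).
    by rewrite Fy /y; ring.
  rewrite normrM; have [_] := YB a a0.
  by case: (chi_sign int p a) => -> /andP[x1 x2]; rewrite ?normrN normr1 mul1r ler_norml;
    move: x1 x2; move: (_ * n%:Z) => c; clear; lia.
- by rewrite hatB subr_ge0; case/andP: (yH u).
Qed.

(** Pieces are indexed by [nat] to spare casts between ordinals of different
    bounds. *)
Lemma lattice_split r F : (0 < r)%N -> lattice_poly r F ->
  exists G : nat -> V -> int, (forall i, (i < r)%N -> lattice_poly 1 (G i)) /\
    forall a, F a = \sum_(i < r) G i a.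
Proof.
elim: r F => // r IH F _ FP.
have [e|r0] := posnP r.
  by rewrite e in FP *; exists (fun=> F); split=> // a; rewrite big_ord1.
have [|y [yP FyP]] := split_off _ FP; first by [].
have [G [GP GE]] := IH _ r0 FyP.
exists (fun i => if (i < r)%N then G i else y); split=> [i _|a].
  by case: ltnP => // /GP.
rewrite big_ord_recr /= ltnn -[LHS](subrK (y a)) GE; congr (_ + _).
by apply: eq_bigr => i _; rewrite ltn_ord.
Qed.

End Normal.

(** * Coordinates on the truncated simplex *)

Lemma F2_index_inj k : injective (@F2_index k).
Proof. by move=> i i' /enum_val_inj /cast_ord_inj. Qed.

Lemma F2_index_surj k (a : 'rV['F_2]_k) : exists i, F2_index i = a.
Proof.
exists (cast_ord (card_F2_row k) (enum_rank a)).
by rewrite /F2_index cast_ordK enum_rankK.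
Qed.

Section Coordinates.
Variables (R : realType) (k : nat) (A : 'M[R]_(2 ^ k)) (j : 'I_(2 ^ k)).
Local Notation V := 'rV['F_2]_k.
Local Notation chi := (@chi R k).
Local Notation N := (order2 R k).

(** In the coordinates [al], up to the signs [b], the vertices of the simplex
    are the nontrivial values of the characters [rw i]. *)
Definition coordinates (al : 'I_(2 ^ k).-1 -> V) (b : 'I_(2 ^ k).-1 -> bool)
    (rw : 'I_(2 ^ k) -> V) : Prop :=
  [/\ injective al, forall a, (exists c, al c = a) <-> a != 0, bijective rw
    & forall i c, simplex_vertex A j i 0 c = (-1) ^+ b c * chi (rw i) (al c)].

Lemma coordinates_exist : signed_equiv A (sylvester R k) ->
  exists al b rw, coordinates al b rw.
Proof.
move=> [p [q [s [t AE]]]].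
pose al c := F2_index (q j) + F2_index (q (lift j c)).
exists al, (fun c => t j (+) t (lift j c)), (fun i => F2_index (p i)); split.
- by move=> c c' /addrI /F2_index_inj /perm_inj /lift_inj.
- move=> a; split=> [[c <-]|a0].
    rewrite addF2_eq0; apply/eqP => /F2_index_inj /perm_inj e.
    by have := neq_lift j c; rewrite -e eqxx.
  have [l le] := F2_index_surj (F2_index (q j) + a).
  have [l' ql] : exists l', q l' = l by exists (perm_inv q l); apply: permKV.
  case: (unliftP j l') => [c lc|lj].
    by exists c; rewrite /al -lc ql le addrC [_ + a]addrC addF2K.
  move: le; rewrite -ql lj => /eqP; rewrite -[X in X == _]addr0.
  by rewrite (inj_eq (@addrI _ _)) eq_sym (negPf a0).
- apply: inj_card_bij => [i i' /F2_index_inj /perm_inj //|].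
  by rewrite card_ord card_F2_row.
have sylE (i i' : 'I_(2 ^ k)) : sylvester R k i i' = chi (F2_index i) (F2_index i').
  by rewrite mxE.
move=> i c; rewrite /simplex_vertex !mxE !AE !sylE /al chiDr signr_addb.
have ss : (-1) ^+ s i * (-1) ^+ s i = 1 :> R by rewrite -expr2 sqrr_sign.
move: ss; move: ((-1) ^+ s i) ((-1) ^+ t j) ((-1) ^+ t (lift j c)) => S T T' ss.
move: (chi _ (F2_index (q j))) (chi _ (F2_index (q (lift j c)))) => x y.
by rewrite -[RHS]mul1r -ss; ring.
Qed.

Variables (al : 'I_(2 ^ k).-1 -> V) (b : 'I_(2 ^ k).-1 -> bool) (rw : 'I_(2 ^ k) -> V).
Hypothesis C : coordinates al b rw.
Implicit Types (f g h w : V -> R).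

Definition pt f : 'rV[R]_(2 ^ k).-1 := \row_c ((-1) ^+ b c * f (al c)).

(** The inverse of [pt], prescribing the value at 0. *)
Definition extend (M : R) (x : 'rV[R]_(2 ^ k).-1) (a : V) : R :=
  if [pick c | al c == a] is Some c then (-1) ^+ b c * x 0 c else M.

Let al_inj : injective al. Proof. by case: C. Qed.
Let al_neq0 c : al c != 0. Proof. by case: C => _ /(_ (al c))[/(_ _)-> //]; exists c. Qed.
Let al_surj a : a != 0 -> exists c, al c = a. Proof. by case: C => _ /(_ a)[_ +] _ _; apply. Qed.

Lemma extend0 M x : extend M x 0 = M.
Proof.
rewrite /extend; case: pickP => // c /eqP e.
by have := al_neq0 c; rewrite e eqxx.
Qed.

Lemma extendK M x : pt (extend M x) = x.
Proof.
apply/rowP => c; rewrite mxE /extend; case: pickP => [c' /eqP /al_inj ->|/(_ c)].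
  by rewrite mulrA -signr_addb addbb mul1r.
by rewrite eqxx.
Qed.

Lemma pt_inj f g : f 0 = g 0 -> pt f = pt g -> f =1 g.
Proof.
move=> e0 /rowP e a; have [->//|/al_surj[c <-]] := eqVneq a 0.
have := e c; rewrite !mxE => /(congr1 (fun x => (-1) ^+ b c * x)).
by rewrite !mulrA -signr_addb addbb !mul1r.
Qed.

Lemma eq_pt f g : f =1 g -> pt f = pt g.
Proof. by move=> fg; apply/rowP => c; rewrite !mxE fg. Qed.

Lemma ptZ x f : x *: pt f = pt (fun a => x * f a).
Proof. by apply/rowP => c; rewrite !mxE mulrCA. Qed.

Lemma ptD f g : pt f + pt g = pt (fun a => f a + g a).
Proof. by apply/rowP => c; rewrite !mxE mulrDr. Qed.

Lemma pt_sum r (G : 'I_r -> V -> R) :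
  \sum_i pt (G i) = pt (fun a => \sum_i G i a).
Proof.
apply/rowP => c; rewrite summxE mxE mulr_sumr.
by apply: eq_bigr => i _; rewrite mxE.
Qed.

Let N0 : 0 < N. Proof. by rewrite order2E ltr0n expn_gt0. Qed.

(** Orthogonality turns barycentric coordinates into values of the transform,
    and inversion does the converse. *)
Lemma simplexP (M : R) f : 0 < M -> f 0 = M ->
  dilate M (hadamard_simplex A j) (pt f) <-> forall u, 0 <= hat f u.
Proof.
case: C => _ _ [wr rwK wrK] vE M0 f0; split.
  move=> [x [a [a0 a1 ->]] fE] u.
  have ff : f =1 (fun d => M * \sum_i a i * chi (rw i) d).
    apply: pt_inj.
      rewrite f0 -[LHS]mulr1 -a1; congr (_ * _).
      by apply: eq_bigr => i _; rewrite chi0r mulr1.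
    rewrite -fE; apply/rowP => c; rewrite !mxE summxE mulrCA; congr (_ * _).
    rewrite mulr_sumr; apply: eq_bigr => i _; rewrite mxE vE; ring.
  rewrite (eq_hat ff) hatZ; apply: mulr_ge0; rewrite /hat; first exact: ltW.
  under eq_bigr do rewrite mulr_sumr; rewrite exchange_big /=.
  apply: sumr_ge0 => i _; under eq_bigr do rewrite mulrCA.
  by have N00 := ltW N0; rewrite -mulr_sumr sum_chiM !mulr_ge0 ?ler0n.
move=> h0; exists (pt (fun a => M^-1 * f a)); last first.
  by rewrite ptZ; apply: eq_pt => a; rewrite mulVKf ?lt0r_neq0.
have nz : N * M != 0 by rewrite mulf_neq0 ?lt0r_neq0.
have re (F : V -> R) : \sum_i F (rw i) = \sum_u F u.
  by rewrite [RHS](reindex rw) //; exists wr => ? _; [apply: rwK|apply: wrK].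
exists (fun i => (N * M)^-1 * hat f (rw i)); split.
- by have N00 := ltW N0; have M00 := ltW M0; move=> i; rewrite mulr_ge0 ?invr_ge0 ?mulr_ge0.
- rewrite -mulr_sumr (re (hat f)) (_ : \sum_u _ = N * M) ?mulVf // -f0 -hat_inv.
  by apply: eq_bigr => u _; rewrite chi0r mulr1.
apply/rowP => c; rewrite summxE mxE.
under eq_bigr do rewrite mxE vE.
rewrite (eq_bigr (fun i => (N * M)^-1 * (-1) ^+ b c * (hat f (rw i) * chi (rw i) (al c)))).
  rewrite -mulr_sumr (re (fun u => hat f u * chi u (al c))) hat_inv.
  by field; rewrite !lt0r_neq0.
by move=> i _; ring.
Qed.

Lemma truncatedP (m n : nat) f : (0 < m)%N -> f 0 = m%:R ->
  truncated_simplex A j m n (pt f) <-> in_poly m%:R n%:R f.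
Proof.
move=> m0 f0; have m0' : 0 < m%:R :> R by rewrite ltr0n.
have cE : cube n (pt f) <-> forall a, a != 0 -> `|f a| <= n%:R.
  split=> [h a /al_surj[c <-]|h c].
    by have := h c; rewrite mxE -ler_norml normrM normr_sign mul1r.
  by rewrite mxE -ler_norml normrM normr_sign mul1r h.
split=> [[/(simplexP m0' f0) h /cE c]|[_ c h]]; first by split.
by split; [apply/(simplexP m0' f0)|apply/cE].
Qed.

Lemma latticeP (n : nat) f :
  shifted_lattice n (pt f) <->
  forall a, a != 0 -> (f a + n%:R) / 2 \is a Num.int.
Proof.
have S c (x : R) : (((-1) ^+ b c * x + n%:R) / 2 \is a Num.int) = ((x + n%:R) / 2 \is a Num.int).
  by apply: half_int; case: (b c); [right|left].
have L (x : R) : (exists z : int, x = n%:R + 2 * z%:~R) <-> (x + n%:R) / 2 \is a Num.int.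
  split=> [[z ->]|/intrP[z e]].
    have -> : (n%:R + 2 * z%:~R + n%:R) / 2 = n%:R + z%:~R :> R by field.
    by rewrite rpredD ?rpred_nat ?rpred_int.
  by exists (z - n%:Z); rewrite intrB -e -pmulrn; field.
split=> h.
  by move=> a /al_surj[c <-]; rewrite -(S c); apply/L; have := h c; rewrite mxE.
by move=> c; rewrite mxE; apply/L; rewrite S h.
Qed.

(** Constraints with positive slack survive a small enough perturbation; the
    step is explicit to avoid a case distinction on [I]. *)
Lemma small_step (I : finType) (g h : I -> R) : (forall i, 0 <= g i) ->
  (forall i, g i = 0 -> h i = 0) -> exists2 e, 0 < e & forall i, e * `|h i| <= g i.
Proof.
move=> g0 gh; pose S := 1 + \sum_i `|h i| / g i.
have t0 i : 0 <= `|h i| / g i by rewrite divr_ge0.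
have S0 : 0 < S by rewrite ltr_pwDl ?sumr_ge0.
exists S^-1; rewrite ?invr_gt0 // => i.
have [gi|gi] := eqVneq (g i) 0; first by rewrite gh // normr0 mulr0.
have gp : 0 < g i by rewrite lt_def gi g0.
rewrite mulrC ler_pdivrMr // mulrC -ler_pdivrMr //.
by rewrite /S (bigD1 i) //= addrCA ler_wpDr // addr_ge0 ?sumr_ge0.
Qed.

Lemma vertexP (m n : nat) f : (0 < m)%N -> in_poly m%:R n%:R f ->
  vertex (truncated_simplex A j m n) (pt f) <-> rigid n%:R f.
Proof.
move=> m0 fP; have [f0 fB fH] := fP; split.
  move=> [_ ext] w w0 wB wH.
  have [||e e0 he] := @small_step (V + V)%type
    (fun i => match i with inl a => if a == 0 then 0 else n%:R - `|f a| | inr u => hat f u end)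
    (fun i => match i with inl a => w a | inr u => hat w u end).
  - by case=> [a|u] //; case: eqVneq => // a0; rewrite subr_ge0 fB.
  - case=> [a|u]; last exact: wH.
    by case: eqVneq => [->|a0 /eqP] // ; rewrite subr_eq0 => /eqP/esym; apply: wB.
  have inP s : s * s = 1 -> truncated_simplex A j m n (pt (fun a => f a + (s * e) * w a)).
    move=> ss; have s1 : `|s| = 1.
      by apply/eqP; rewrite -(@eqrXn2 _ 2) // ?expr1n -?normrX ?expr2 ?ss ?normr1.
    apply/truncatedP => //; first by rewrite w0 mulr0 addr0.
    split=> [|a a0|u]; first by rewrite w0 mulr0 addr0.
      have := he (inl a); rewrite (negPf a0) => h.
      apply: le_trans (ler_normD _ _) _.
      by rewrite !normrM s1 mul1r (gtr0_norm e0) -lerBrDl.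
    rewrite hatD hatZ; have := he (inr u).
    rewrite -[X in X * _](gtr0_norm e0) -normrM -[X in X <= _]mul1r -s1 -normrM mulrA.
    by rewrite ler_norml => /andP[h _]; rewrite -lerBlDl sub0r.
  have h1 := inP 1 (mulr1 _).
  have h2 : truncated_simplex A j m n (pt (fun a => f a + (-1 * e) * w a)).
    by apply: inP; rewrite mulrNN mulr1.
  have [||/pt_inj h _] := ext _ _ (2^-1) h1 h2.
  - by apply/andP; split; lra.
  - by rewrite !ptZ ptD; apply: eq_pt => a; field.
  move=> a; have := h _ a; rewrite w0 mulr0 addr0 => /(_ erefl) /eqP.
  by rewrite -subr_eq0 addrAC subrr add0r mul1r mulf_eq0 (gt_eqF e0) => /eqP.
move=> rig; split; first exact/truncatedP.
move=> x y t; rewrite -(extendK m%:R x) -(extendK m%:R y).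
move: (extend m%:R x) (extend m%:R y) (extend0 m%:R x) (extend0 m%:R y) => g h g0 h0.
move=> /(truncatedP n m0 g0)[_ gB gH] /(truncatedP n m0 h0)[_ hB hH] /andP[t0 t1] e.
have {}e a : f a = t * g a + (1 - t) * h a.
  move: e; rewrite !ptZ ptD => /pt_inj; apply.
  by rewrite f0 g0 h0; ring.
have s0 : 0 < 1 - t by rewrite subr_gt0.
have gf a : g a - f a = 0.
  apply: (rig (fun a => g a - f a)).
  - by rewrite g0 f0 subrr.
  - move=> c c0; have := gB c c0; have := hB c c0; rewrite e !ler_norml.
    move=> /andP[h1 h2] /andP[g1 g2].
    have [fc fn|fc fn] := ger0P (t * g c + (1 - t) * h c).
      have : 0 <= (1 - t) * (n%:R - h c) by rewrite mulr_ge0 ?(ltW s0) ?subr_ge0.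
      have : 0 <= t * (n%:R - g c) by rewrite mulr_ge0 ?(ltW t0) ?subr_ge0.
      move=> k1 k2; have : t * (n%:R - g c) = 0 by lra.
      by move/eqP; rewrite mulf_eq0 (gt_eqF t0) /= => /eqP; lra.
    have : 0 <= (1 - t) * (h c + n%:R) by rewrite mulr_ge0 ?(ltW s0) // -[n%:R]opprK subr_ge0.
    have : 0 <= t * (g c + n%:R) by rewrite mulr_ge0 ?(ltW t0) // -[n%:R]opprK subr_ge0.
    move=> k1 k2; have : t * (g c + n%:R) = 0 by lra.
    by move/eqP; rewrite mulf_eq0 (gt_eqF t0) /= => /eqP; lra.
  move=> u fu.
  have eu : t * hat g u + (1 - t) * hat h u = 0.
    by rewrite -!hatZ -hatD -fu; apply/esym/eq_hat/e.
  have k1 : 0 <= t * hat g u by rewrite mulr_ge0 ?gH ?(ltW t0).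
  have k2 : 0 <= (1 - t) * hat h u by rewrite mulr_ge0 ?hH ?(ltW s0).
  have gu : hat g u = 0.
    have : t * hat g u = 0 by lra.
    by move/eqP; rewrite mulf_eq0 (gt_eqF t0) /= => /eqP.
  by rewrite hatB gu fu subrr.
have gf' a : g a = f a by apply/eqP; rewrite -subr_eq0 gf.
split; apply: eq_pt => // a.
have := e a; rewrite gf' => ea.
have : (1 - t) * (h a - f a) = 0 by move: ea; lra.
by move/eqP; rewrite mulf_eq0 (gt_eqF s0) /= subr_eq0 => /eqP.
Qed.

End Coordinates.

(** * A vertex off the lattice *)

Lemma four_equations (R : realFieldType) (s0 s1 s2 s3 : R) :
  s0 = 0 -> s1 = 0 -> s2 = 0 -> s3 = 0 -> forall w1 w2 w3 w4 : R,
    s0 = w1 + (w2 + (w3 + w4)) -> s1 = - w1 + (w2 + (w3 - w4)) ->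
    s2 = w1 + (- w2 + (w3 - w4)) -> s3 = w1 + (w2 + (- w3 - w4)) ->
  [/\ w1 = 0, w2 = 0, w3 = 0 & w4 = 0].
Proof. by move=> -> -> -> -> w1 w2 w3 w4 e0 e1 e2 e3; split; lra. Qed.

(** The four rows are 0 and the first three basis vectors, and the fifth
    character comes from the fourth one.  Everything depends on the first four
    bits only. *)
Section Example.
Variables (R : realType) (k m n : nat).
Hypotheses (k3 : (3 < k)%N) (n0 : (0 < n)%N).
Local Notation V := 'rV['F_2]_k.
Local Notation chi := (@chi R k).
Local Notation N := (order2 R k).
Local Notation K := ((2 ^ (k - 4))%:R : R).
Hypothesis mE : m%:R + n%:R = 6 * K * n%:R - 2 :> R.

Local Notation bits4 := (bool * bool * bool * bool)%type.

Definition coordinate (i : 'I_4) : 'I_k := widen_ord k3 i.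

Definition basis (i : 'I_4) : V := delta_mx 0 (coordinate i).

Definition bit (i : 'I_4) (a : V) : bool := odd (a 0 (coordinate i)).

(** The encoding of the span of four basis vectors by bits is an inverse of
    [combine]. *)
Definition bits (a : V) : bits4 :=
  (bit (inord 0) a, bit (inord 1) a, bit (inord 2) a, bit (inord 3) a).

Definition scale (x : bool) (a : V) : V := if x then a else 0.

Definition combine (b : bits4) : V :=
  let: (b0, b1, b2, b3) := b in
  scale b0 (basis (inord 0)) + scale b1 (basis (inord 1))
  + scale b2 (basis (inord 2)) + scale b3 (basis (inord 3)).

Definition dot (b x : bits4) : bool :=
  let: (b0, b1, b2, b3) := b in let: (x0, x1, x2, x3) := x in
  (b0 && x0) (+) (b1 && x1) (+) (b2 && x2) (+) (b3 && x3).

Lemma chi_basis i a : chi (basis i) a = (-1) ^+ bit i a.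
Proof. by rewrite chi_delta -signr_odd. Qed.

Lemma chi_combine b a : chi (combine b) a = (-1) ^+ dot b (bits a).
Proof.
case: b => [[[b0 b1] b2] b3].
have S x i : chi (scale x (basis i)) a = (-1) ^+ (x && bit i a).
  by case: x; rewrite /= ?chi_basis // chi0l.
by rewrite /combine !chiDl !S -!signr_addb.
Qed.

Lemma sign_inj : injective (fun x : bool => (-1) ^+ x : R).
Proof. by case; case=> //= /eqP; rewrite ?sign_neq ?sign_neqN. Qed.

Lemma bit_basis (i i' : 'I_4) : bit i (basis i') = (i == i').
Proof.
have I : injective coordinate by move=> c d /(congr1 val) /= /val_inj.
by rewrite /bit mxE eqxx (inj_eq I); case: (i == i').
Qed.

Lemma bitD i a a' : bit i (a + a') = bit i a (+) bit i a'.
Proof. by apply: sign_inj; rewrite signr_addb -!chi_basis chiDr. Qed.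

Lemma bits_combine b : bits (combine b) = b.
Proof.
case: b => [[[b0 b1] b2] b3]; rewrite /combine /bits.
have S x i i' : bit i (scale x (basis i')) = x && (i == i').
  by case: x => /=; [exact: bit_basis|rewrite /bit mxE].
have I (c d : nat) : (c < 4)%N -> (d < 4)%N -> (inord c == inord d :> 'I_4) = (c == d).
  by move=> c4 d4; rewrite -val_eqE /= !inordK.
rewrite !bitD !S !I //=.
by rewrite !andbT !andbF !addbF !addFb ?addbF.
Qed.

Lemma combine_inj : injective combine.
Proof. exact: can_inj bits_combine. Qed.

Lemma combine0 : combine (false, false, false, false) = 0.
Proof. by rewrite /= !addr0. Qed.

Lemma sum_indicator (g : V -> R) d : \sum_a g a * (a == d)%:R = g d.
Proof.
rewrite (bigD1 d) //= eqxx mulr1 big1 ?addr0 // => a /negPf ->.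
exact: mulr0.
Qed.

Lemma sum_support (g : V -> R) (D : seq V) : uniq D ->
  (forall a, a \notin D -> g a = 0) -> \sum_a g a = \sum_(a <- D) g a.
Proof.
move=> uD g0; rewrite (bigID (mem D)) /= [X in _ + X]big1 ?addr0 //.
by rewrite -big_uniq.
Qed.

(** Eight times the Fourier coefficients of the sign pattern [shape]. *)
Definition coef (b : bits4) : int :=
  match b with
  | (true, true, true, true) | (false, false, false, true) => 3
  | (_, _, _, true) => -1
  | (false, false, false, false) | (true, false, false, false)
  | (false, true, false, false) | (false, false, true, false) => -3
  | _ => 1
  end.

(** Minus the sign of the sum of the characters of the four rows, where that sum
    is nonzero (true stands for -1), and the fifth character where it vanishes. *)
Definition shape (x : bits4) : bool :=
  match x with
  | (true, true, true, _) => false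
  | (true, true, false, x3) | (true, false, true, x3) | (false, true, true, x3) => x3
  | _ => true
  end.

Lemma sum_pair_bool (I : finType) (g : I * bool -> int) :
  \sum_p g p = \sum_i (g (i, true) + g (i, false)).
Proof.
rewrite (eq_bigr (fun p => g (p.1, p.2))) => [|[] //].
rewrite -(pair_bigA _ (fun i x => g (i, x))) /=.
by apply: eq_bigr => i _; rewrite big_bool.
Qed.

Lemma coef_shape (x : bits4) :
  \sum_b coef b * (-1) ^+ dot b x = 8 * (-1) ^+ shape x.
Proof.
rewrite !sum_pair_bool big_bool.
by case: x => [[[[] []] []] []].
Qed.

Definition nodes : seq V := [seq combine b | b <-
  [:: (true, false, false, false); (false, true, false, false);
      (false, false, true, false); (true, true, true, false)]].

Definition bump_at (a : V) : R :=
  (a == combine (true, false, false, false))%:R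
  + (a == combine (false, true, false, false))%:R
  + (a == combine (false, false, true, false))%:R
  - (a == combine (true, true, true, false))%:R.

Definition example (a : V) : R :=
  n%:R * (-1) ^+ shape (bits a) + (m%:R + n%:R) * (a == 0)%:R + bump_at a.

Lemma hat_shape u :
  hat (fun a => (-1) ^+ shape (bits a)) u =
  2 * K * \sum_b (coef b)%:~R * (u == combine b)%:R.
Proof.
apply: (@mulfI _ 8); first by rewrite pnatr_eq0.
rewrite /hat mulr_sumr.
rewrite (eq_bigr (fun a => \sum_b (coef b)%:~R * (chi u a * chi (combine b) a))).
  have NE : 8 * (2 * K) = N by rewrite (order16 _ k3) mulrA -[8 * 2]natrM.
  rewrite exchange_big /= [RHS]mulrA NE mulr_sumr.
  by apply: eq_bigr => b _; rewrite -mulr_sumr sum_chiM [_ * N]mulrC mulrCA.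
move=> a _.
rewrite mulrCA -[8]/(8%:~R) -(rmorph_sign (intr : int -> R)) -rmorphM -coef_shape.
rewrite rmorph_sum mulr_sumr; apply: eq_bigr => b _.
by rewrite rmorphM /= rmorph_sign chi_combine mulrCA.
Qed.

Lemma hat_example u : hat example u =
  2 * K * n%:R * (3 + \sum_b (coef b)%:~R * (u == combine b)%:R) - 2
  + ((-1) ^+ dot (true, false, false, false) (bits u)
  + (-1) ^+ dot (false, true, false, false) (bits u)
  + (-1) ^+ dot (false, false, true, false) (bits u)
  - (-1) ^+ dot (true, true, true, false) (bits u)).
Proof.
rewrite -!chi_combine !(chiC R _ u).
rewrite [LHS](eq_bigr (fun a => n%:R * (chi u a * (-1) ^+ shape (bits a))
  + (m%:R + n%:R) * (chi u a * (a == 0)%:R)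
  + (chi u a * (a == combine (true, false, false, false))%:R
  + chi u a * (a == combine (false, true, false, false))%:R
  + chi u a * (a == combine (false, false, true, false))%:R
  - chi u a * (a == combine (true, true, true, false))%:R))); last first.
  by move=> a _; rewrite /example /bump_at !mulrDr mulrN (mulrCA _ n%:R) (mulrCA _ (_ + _)).
rewrite !big_split /= sumrN -!mulr_sumr !sum_indicator chi0r mulr1.
rewrite -/(hat (fun a => (-1) ^+ shape (bits a)) u) hat_shape mE.
congr (_ + _); move: (\sum_b _) K => S c; ring.
Qed.

Lemma coef_combine b : \sum_b' (coef b')%:~R * (combine b == combine b')%:R = (coef b)%:~R :> R.
Proof.
rewrite (bigD1 b) //= eqxx mulr1 big1 ?addr0 // => b' nb.
by rewrite (inj_eq combine_inj) eq_sym (negPf nb) mulr0.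
Qed.

Let Kn1 : 1 <= K * n%:R.
Proof. by rewrite -natrM ler1n muln_gt0 expn_gt0 n0. Qed.

(** The transform is 2 K n (3 + c) - 2 plus a sum of four signs with product -1,
    where c is a Fourier coefficient, at least -3.  The signs add up to 2 or -2,
    with 2 at the four rows where c = -3, and K n >= 1 covers the others. *)
Lemma hat_example_ge0 u : 0 <= hat example u.
Proof.
rewrite hat_example.
have [/existsP[b /eqP ->]|] := boolP [exists b, u == combine b].
  rewrite coef_combine bits_combine; move: Kn1; rewrite -[2 * _ * _]mulrA.
  move: (K * n%:R) => c.
  by case: b => [[[[] []] []] []]; rewrite /= ?expr0 ?expr1; lra.
rewrite negb_exists => /forallP h; rewrite big1 => [|b _]; last first.
  by rewrite (negPf (h b)) mulr0.
move: Kn1; rewrite -[2 * _ * _]mulrA; move: (K * n%:R) => c.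
by case: (bits u) => [[[[] []] []] []]; rewrite /= ?expr0 ?expr1; lra.
Qed.

Lemma hat_example_eq0 b :
  b \in [:: (false, false, false, false); (true, false, false, false);
            (false, true, false, false); (false, false, true, false)] ->
  hat example (combine b) = 0.
Proof.
rewrite hat_example coef_combine bits_combine !inE.
by move=> /or4P[] /eqP ->; rewrite /= ?expr0 ?expr1; ring.
Qed.

Lemma bump_nodes a : a \notin nodes -> bump_at a = 0.
Proof.
rewrite !inE !negb_or /bump_at => /and4P[/negPf -> /negPf -> /negPf -> /negPf ->].
by rewrite [false%:R]mulr0n !addr0 subr0.
Qed.

Lemma example_node b : b \in [:: (true, false, false, false);
     (false, true, false, false); (false, false, true, false)] ->
  example (combine b) = - n%:R + 1.
Proof.
rewrite /example /bump_at -combine0 !(inj_eq combine_inj) bits_combine !inE.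
by move=> /or3P[] /eqP ->; rewrite /= ?expr1; ring.
Qed.

Lemma example_node3 : example (combine (true, true, true, false)) = n%:R - 1.
Proof.
rewrite /example /bump_at -combine0 !(inj_eq combine_inj) bits_combine /= ?expr0; ring.
Qed.

Lemma example_other a : a != 0 -> a \notin nodes -> `|example a| = n%:R.
Proof.
move=> /negPf a0 /bump_nodes ba; rewrite /example a0 ba mulr0 !addr0.
by rewrite normrM normr_sign mulr1 normr_nat.
Qed.

Lemma example_poly : in_poly m%:R n%:R example.
Proof.
split; last exact: hat_example_ge0.
  rewrite /example /bump_at -combine0 !(inj_eq combine_inj) bits_combine /= ?expr1; ring.
have n1 : 1 <= n%:R :> R by rewrite ler1n.
move=> a a0; have [|/example_other -> //] := boolP (a \in nodes).
rewrite !inE => /or4P[] /eqP ->; last rewrite example_node3 ger0_norm ?subr_ge0 //; rewrite ?gerBl //;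
  by rewrite example_node // addrC -normrN opprB ger0_norm ?subr_ge0 ?gerBl.
Qed.

(** Only the four moved coordinates are not extremal, and the four tight rows
    restrict to an invertible matrix on them. *)
Lemma example_rigid : rigid n%:R example.
Proof.
move=> w w0 wB wH.
have off a : a \notin nodes -> w a = 0.
  by move=> an; have [->//|a0] := eqVneq a 0; apply: wB => //; apply: example_other.
have hw b : hat w (combine b) = \sum_(b' <- [:: (true, false, false, false);
    (false, true, false, false); (false, false, true, false);
    (true, true, true, false)]) (-1) ^+ dot b b' * w (combine b').
  rewrite /hat (@sum_support _ nodes).
  - by rewrite big_map; apply: eq_bigr => b' _; rewrite chi_combine bits_combine.
  - by rewrite map_inj_uniq //; apply: combine_inj.
  - by move=> a /off ->; rewrite mulr0.
have e b bb := etrans (esym (hw b)) (wH _ (hat_example_eq0 bb)).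
have := four_equations (e (false, false, false, false) isT)
  (e (true, false, false, false) isT) (e (false, true, false, false) isT)
  (e (false, false, true, false) isT).
move=> h a; have [|/off //] := boolP (a \in nodes); rewrite !inE.
have [] := h (w (combine (true, false, false, false)))
  (w (combine (false, true, false, false))) (w (combine (false, false, true, false)))
  (w (combine (true, true, true, false))).
- by rewrite !big_cons big_nil addr0 /= !expr0 !mul1r.
- by rewrite !big_cons big_nil addr0 /= !expr0 !expr1 !mul1r !mulN1r.
- by rewrite !big_cons big_nil addr0 /= !expr0 !expr1 !mul1r !mulN1r.
- by rewrite !big_cons big_nil addr0 /= !expr0 !expr1 !mul1r !mulN1r.
by move=> h1 h2 h3 h4 /or4P[] /eqP ->.
Qed.

Lemma example_not_int :
  exists2 a, a != 0 & (example a + n%:R) / 2 \isn't a Num.int.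
Proof.
exists (combine (true, false, false, false)).
  by rewrite -combine0 (inj_eq combine_inj).
rewrite example_node //; apply/negP => /intrP[z].
have -> : (- n%:R + 1 + n%:R) / 2 = 2^-1 :> R by field.
move=> /(congr1 (fun x => 2 * x)); rewrite mulfV ?pnatr_eq0 //.
rewrite -[1]/(1%:~R) -[2]/(2%:~R) -intrM => /intr_inj; lia.
Qed.

End Example.

(** * The integrality and normality bands *)

Section Transfer.
Variables (R : realType) (k : nat) (A : 'M[R]_(2 ^ k)) (j : 'I_(2 ^ k)).
Local Notation V := 'rV['F_2]_k.
Variables (al : 'I_(2 ^ k).-1 -> V) (b : 'I_(2 ^ k).-1 -> bool) (rw : 'I_(2 ^ k) -> V).
Hypotheses (k3 : (3 < k)%N) (C : coordinates A j al b rw).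
Variables (m n : nat).
Hypothesis mn : admissible (2 ^ k) m n.

Let on : odd n. Proof. by case/and4P: mn. Qed.
Let om : odd m. Proof. by case/and4P: mn. Qed.
Let m0 : (0 < m)%N. Proof. exact: odd_gt0. Qed.

Lemma hat_intr (F : V -> int) u : hat (fun a => (F a)%:~R : R) u = (hat F u)%:~R.
Proof.
rewrite /hat rmorph_sum; apply: eq_bigr => a _; rewrite rmorphM; congr (_ * _).
by rewrite /chi -signr_odd -[in RHS]signr_odd rmorph_sign.
Qed.

Lemma order2_int : order2 R k = (order2 int k)%:~R.
Proof. by rewrite !order2E rmorph_nat. Qed.

Lemma integral_of_rho : rho R (2 ^ k) * n%:R <= m%:R -> integral_polytope A j m n.
Proof.
move=> mr v; rewrite -(extendK C m%:R v) => vP.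
have f0 := extend0 C m%:R v.
have [Pv _] := vP.
have fP := (truncatedP C n m0 f0).1 Pv.
apply/(latticeP C) => a a0.
apply: (rigid_integral k3 om on fP _ _ a0); first exact/(vertexP C m0 fP).
move: mr; rewrite /rho -order2E; move: (order2 R k) => N mr.
have : 8 * ((3 * N / 8 - 1) * n%:R) <= 8 * m%:R by rewrite ler_pM2l.
by apply: le_trans; rewrite le_eqVlt; apply/orP; left; apply/eqP; field.
Qed.

Lemma normal_of_rho :
  rho R (2 ^ k) * n%:R + (2 ^ k)%:R - 2 <= m%:R -> normal_polytope A j m n.
Proof.
move=> mr P r x r1 [y Py yx] xL.
have g0 := extend0 C m%:R y; have gy := extendK C m%:R y.
move: (extend al b m%:R y) g0 gy => g g0 gy.
have [_ gB gH] := (truncatedP C n m0 g0).1 (eq_rect_r P Py gy).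
have le_int : n%:Z * (3 * order2 int k - 8) + 8 * (order2 int k - 2) <= 8 * m%:Z.
  rewrite -(ler_int R) !(rmorphD, rmorphM, rmorphB) /= -!order2_int -!pmulrn.
  move: mr; rewrite /rho -order2E; move: (order2 R k) => N mr.
  have : 8 * ((3 * N / 8 - 1) * n%:R + N - 2) <= 8 * m%:R by rewrite ler_pM2l.
  by apply: le_trans; rewrite le_eqVlt; apply/orP; left; apply/eqP; field.
have xE : x = pt al b (fun a => r%:R * g a) by rewrite -yx -gy ptZ.
have Fz a : exists z : int, r%:R * g a = (r%:Z * n%:Z + 2 * z)%:~R.
  have [->|a0] := eqVneq a 0.
    rewrite g0; have [z e] : exists z : int, m%:Z = n%:Z + 2 * z.
      by exists ((m./2)%:Z - (n./2)%:Z); move: om on; lia.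
    exists (r%:Z * z); rewrite (_ : _ + _ = r%:Z * m%:Z); last by rewrite e; ring.
    by rewrite rmorphM.
  move: xL; rewrite xE => /(latticeP C)/(_ a a0)/intrP[z e].
  exists (z - r%:Z * n%:Z).
  rewrite (_ : _ + _ = 2 * z - r%:Z * n%:Z); last by ring.
  by rewrite rmorphB !rmorphM /= -e -!pmulrn natrM; field.
have [z zE] := fin_all_exists Fz.
pose F a := r%:Z * n%:Z + 2 * z a.
have FP : lattice_poly m n r F.
  split; last by move=> a; exists (z a).
  split.
  - apply: (@intr_inj R); rewrite -zE g0 rmorphM /= -!pmulrn //.
  - move=> a a0; rewrite -(ler_int R) intr_norm -zE rmorphM /= -!pmulrn.
    by rewrite normrM normr_nat ler_wpM2l ?gB.
  move=> u; rewrite -(ler_int R) -hat_intr (eq_hat (fun a => esym (zE a))).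
  by rewrite hatZ mulr_ge0.
have [G [GP GE]] := lattice_split k3 om on le_int r1 FP.
exists (fun i => pt al b (fun a => (G i a)%:~R)); split=> [i|].
  have [[G0 GB GH] GL] := GP i (ltn_ord i).
  split.
    have Gm : (G i 0)%:~R = m%:R :> R by rewrite G0 mul1r -pmulrn.
    apply/(truncatedP C) => //; split=> // [a a0|u].
      by have := GB a a0; rewrite mul1r -(ler_int R) intr_norm -pmulrn.
    by rewrite hat_intr ler0z.
  apply/(latticeP C) => a _; have [w ->] := GL a.
  rewrite mul1r rmorphD rmorphM /= -!pmulrn.
  have -> : (n%:R + 2 * w%:~R + n%:R) / 2 = n%:R + w%:~R :> R by field.
  by rewrite rpredD ?rpred_nat ?rpred_int.
rewrite xE pt_sum; apply: eq_pt => a.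
by rewrite zE -/(F a) GE rmorph_sum.
Qed.

End Transfer.

Theorem theorem4p8 (R : realType) (k : nat) (hN : (16 <= 2 ^ k)%N)
    (A : 'M[R]_(2 ^ k)) (hA : signed_equiv A (sylvester R k))
    (j : 'I_(2 ^ k)) :
  [/\ forall m n : nat, admissible (2 ^ k) m n ->
        rho R (2 ^ k) * n%:R <= m%:R -> integral_polytope A j m n,
      forall m n : nat, admissible (2 ^ k) m n ->
        rho R (2 ^ k) * n%:R + (2 ^ k)%:R - 2 <= m%:R ->
        normal_polytope A j m n,
      forall n : nat, odd n ->
        exists m : nat,
          [/\ m%:R = rho R (2 ^ k) * n%:R - 2, admissible (2 ^ k) m n
            & exists v, vertex (truncated_simplex A j m n) v /\
                        ~ shifted_lattice n v]
    & forall c : R, c < rho R (2 ^ k) ->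
        exists m n : nat,
          [/\ admissible (2 ^ k) m n, c * n%:R <= m%:R
            & ~ integral_polytope A j m n]].
Proof.
have k3 : (3 < k)%N by rewrite -(@leq_exp2l 2).
have [al [b [rw C]]] := coordinates_exist j hA.
have rhoE : rho R (2 ^ k) = 6 * (2 ^ (k - 4))%:R - 1.
  by rewrite /rho -order2E order16 //; move: (_ ^ _)%:R => K; field.
have sharp n : odd n -> exists m : nat,
    [/\ m%:R = rho R (2 ^ k) * n%:R - 2, admissible (2 ^ k) m n
      & exists v, vertex (truncated_simplex A j m n) v /\ ~ shifted_lattice n v].
  move=> on; have n0 := odd_gt0 on.
  have NK : (2 ^ k = 16 * 2 ^ (k - 4))%N by rewrite -(@expnD 2 4) subnKC.
  have K0 : (0 < 2 ^ (k - 4))%N by rewrite expn_gt0.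
  have [m me] : exists m, (m + n + 2 = 6 * 2 ^ (k - 4) * n)%N.
    by exists (6 * 2 ^ (k - 4) * n - n - 2)%N; move: K0 n0; nia.
  have mR : m%:R + n%:R = 6 * (2 ^ (k - 4))%:R * n%:R - 2 :> R.
    by rewrite -[6]/(6%:R) -!natrM -me !natrD addrK.
  have mn : admissible (2 ^ k) m n.
    rewrite /admissible on NK; move: (2 ^ (k - 4))%N K0 me => K K0 me.
    have : odd (m + n + 2) = odd (6 * K * n) by rewrite me.
    rewrite !oddD !oddM on /= !addbF addbT => /negbFE ->; nia.
  have m0 : (0 < m)%N by case/and4P: mn => _ /odd_gt0.
  exists m; split=> //.
    by rewrite rhoE mulrBl mul1r -[RHS]addrAC -mR addrK.
  have eP := example_poly k3 n0 mR; have [e0 _ _] := eP.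
  exists (pt al b (example R m n k3)); split.
    by apply/(vertexP C m0 eP); exact: example_rigid mR.
  have [a a0 /negP na] := example_not_int R m k3 n0.
  by move=> /(latticeP C)/(_ a a0).
split=> //.
- by move=> m n mn; apply: (integral_of_rho k3 C mn).
- by move=> m n mn; apply: (normal_of_rho k3 C mn).
move=> c cr; have d0 : 0 < rho R (2 ^ k) - c by rewrite subr_gt0.
pose n := (Num.trunc (2 / (rho R (2 ^ k) - c))).*2.+1.
have on : odd n by rewrite /= odd_double.
have nb : 2 / (rho R (2 ^ k) - c) <= n%:R.
  have := truncnS_gt (2 / (rho R (2 ^ k) - c)).
  by move/ltW/le_trans; apply; rewrite ler_nat ltnS -addnn leq_addr.
have [m [mE mn [v [vV vL]]]] := sharp n on.
exists m, n; split=> // [|/(_ v vV) //].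
rewrite mE [c * _]mulrC [rho _ _ * _]mulrC; move: nb; rewrite ler_pdivrMr // mulrBr.
by move: (n%:R * c) (n%:R * _) => s t; clear; lra.
Qed.
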